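(* Let $\mathbb A$ be an ACGW category. (1) (Functoriality.) For every $n$ there is a functor $H_n:\mathrm{Ch}_{\mathbb A}\to\mathbb A^\flat$ whose value on a chain complex $X_\bullet$ is its $n$-th homology $H_n(X_\bullet)$ and whose value on a morphism of chain complexes $f_\bullet:X_\bullet\to Y_\bullet$ is the induced morphism $H_n(f_\bullet)$, represented by a span $H_n(X_\bullet)\dashleftarrow\cdot\rightarrowtail H_n(Y_\bullet)$. (2) (Snake Lemma.) Suppose given in $\mathbb A$ three rows $$A\dashleftarrow\bar A\rightarrowtail B\dashleftarrow C = C,\qquad X = X\rightarrowtail Y\dashleftarrow Z=Z,\qquad A'=A'\rightarrowtail B'\dashleftarrow\bar C'\rightarrowtail C',$$ where $\bar A\rightarrowtail B\dashleftarrow C$ and $A'\rightarrowtail B'\dashleftarrow\bar C'$ are kernel-cokernel pairs, together with vertical morphisms $X\dashrightarrow A$, $X\dashrightarrow\bar A$, $Y\dashrightarrow B$, $Z\dashrightarrow C$ and horizontal morphisms $X\rightarrowtail A'$, $Y\rightarrowtail B'$, $Z\rightarrowtail\bar C'$, $Z\rightarrowtail C'$, which form a morphism of sequences from the first row to the third, i.e.: the composite $X\dashrightarrow\bar A\dashrightarrow A$ is the given $X\dashrightarrow A$; the square with horizontal sides $X\rightarrowtail Y$, $\bar A\rightarrowtail B$ and vertical sides $X\dashrightarrow\bar A$, $Y\dashrightarrow B$ is pseudo-commutative; the composites $Z\dashrightarrow Y\dashrightarrow B$ and $Z\dashrightarrow C\dashrightarrow B$ agree; the composites $X\rightarrowtail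 Y\rightarrowtail B'$ and $X\rightarrowtail A'\rightarrowtail B'$ agree; the square with horizontal sides $Z\rightarrowtail\bar C'$, $Y\rightarrowtail B'$ and vertical sides $Z\dashrightarrow Y$, $\bar C'\dashrightarrow B'$ is pseudo-commutative; the composite $Z\rightarrowtail\bar C'\rightarrowtail C'$ is the given $Z\rightarrowtail C'$. Then there are objects $D,W,D'$ and a sequence $$A\backslash X\dashleftarrow \bar A\backslash X\rightarrowtail B\backslash Y\dashleftarrow D\rightarrowtail C\backslash Z\dashleftarrow W\rightarrowtail A'/X\dashleftarrow D'\rightarrowtail B'/Y\dashleftarrow \bar C'/Z\rightarrowtail C'/Z$$ which is exact at its interior terms: $\bar A\backslash X\rightarrowtail B\backslash Y\dashleftarrow D$, $D\rightarrowtail C\backslash Z\dashleftarrow W$, $W\rightarrowtail A'/X\dashleftarrow D'$ and $D'\rightarrowtail B'/Y\dashleftarrow\bar C'/Z$ are kernel-cokernel pairs. (3) (Long exact sequence of a relative pair.) Every short exact sequence of chain complexes $X_\bullet\rightarrowtail Y_\bullet\dashleftarrow Y_\bullet/X_\bullet$ in $\mathbb A$ induces a long exact sequence in homology, i.e. an exact chain complex in $\mathbb A$ of the form $$\cdots H_{i+1}(Y_\bullet/X_\bullet)\dashleftarrow\cdot\rightarrowtail H_i(X_\bullet)\dashleftarrow\cdot\rightarrowtail H_i(Y_\bullet)\dashleftarrow\cdot\rightarrowtail H_i(Y_\bullet/X_\bullet)\dashleftarrow\cdot\rightarrowtail H_{i-1}(X_\bullet)\cdots$$ in which the morphisms $H_i(X_\bullet)\to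 H_i(Y_\bullet)\to H_i(Y_\bullet/X_\bullet)$ are those induced by $X_\bullet\rightarrowtail Y_\bullet$ and $Y_\bullet\dashleftarrow Y_\bullet/X_\bullet$.
   Context: Double categories. A double category $\mathbb A$ has objects, horizontal morphisms $A\rightarrowtail B$, vertical morphisms $A\dashrightarrow B$ (also written $B\dashleftarrow A$), and pseudo-commutative squares, each with a boundary consisting of horizontal sides $A\rightarrowtail B$ (top), $C\rightarrowtail D$ (bottom) and vertical sides $A\dashrightarrow C$ (left), $B\dashrightarrow D$ (right); all have associative unital compositions. A square is determined by its boundary, so being pseudo-commutative is a property of the boundary. ''Commutative square'' refers to an ordinary commutative square of horizontal morphisms only or of vertical morphisms only. ACGW categories. An ACGW category is a double category $\mathbb A$ with the following structure. (a) An object $\varnothing$ is initial for both horizontal and vertical morphisms, and all horizontal and all vertical morphisms are monic. Horizontal and vertical isomorphisms are identified with each other (compatibly with composition); a boundary with two parallel sides isomorphisms is pseudo-commutative exactly when it commutes after this identification. (b) For each object $B$ there are mutually inverse bijections $c,k$ between (isomorphism classes over $B$ of) horizontal morphisms into $B$ and vertical morphisms into $B$. For horizontal $A\rightarrowtail B$, the vertical morphism $c(A\rightarrowtail B)$ is written $B/A\dashrightarrow B$ (cokernel); for vertical $A\dashrightarrow B$, the horizontal morphism $k(A\dashrightarrow B)$ is written $B\backslash A\rightarrowtail B$ (kernel). (c) $c$ and $k$ are natural: $c$ extends to an equivalence from the category of horizontal morphisms and pseudo-commutative squares to the category of vertical morphisms and pullback squares of vertical morphisms. It sends the square with top $A\rightarrowtail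 B$, bottom $C\rightarrowtail D$, right side $B\dashrightarrow D$ to a pullback square of vertical morphisms with top $B/A\dashrightarrow B$, bottom $D/C\dashrightarrow D$, the same right side, and left side an induced vertical morphism $B/A\dashrightarrow D/C$. For a fixed right side this is a bijection (up to isomorphism) between such pseudo-commutative squares and such pullback squares. Analogously $k$ extends to an equivalence from the category of vertical morphisms and pseudo-commutative squares to the category of horizontal morphisms and pullback squares. (d) For each $A\rightarrowtail C\dashleftarrow B$ there is a pseudo-commutative square, unique up to unique isomorphism, with bottom $A\rightarrowtail C$ and right side $B\dashrightarrow C$; its upper left corner is denoted $A\oslash_C B$. A pair $A\rightarrowtail B\dashleftarrow C$ is a kernel-cokernel pair (short exact sequence) if $A\rightarrowtail B$ is isomorphic to the kernel of $C\dashrightarrow B$, equivalently $C\dashrightarrow B$ is isomorphic to the cokernel of $A\rightarrowtail B$. Flattening. $\mathbb A^\flat$ is the ordinary category with the objects of $\mathbb A$, with morphisms $A\to B$ the isomorphism classes of spans $A\dashleftarrow\bar A\rightarrowtail B$, and with the composite of $A\dashleftarrow\bar A\rightarrowtail B$ and $B\dashleftarrow\bar B\rightarrowtail C$ equal to $A\dashleftarrow\bar A\oslash_B\bar B\rightarrowtail C$. The zero morphism is the one with $\bar A=\varnothing$. Chain complexes. A chain complex $X_\bullet$ in $\mathbb A$ is a sequence of morphisms $d_i:X_i\to X_{i-1}$ in $\mathbb A^\flat$, represented by spans $X_i\dashleftarrow\bar X_i\rightarrowtail X_{i-1}$, with $d_id_{i+1}=0$; that is, $\bar X_{i+1}\oslash_{X_i}\bar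 X_i=\varnothing$. By (c) this yields a vertical morphism $\bar X_i\dashrightarrow X_i/\bar X_{i+1}$ and a horizontal morphism $\bar X_{i+1}\rightarrowtail X_i\backslash\bar X_i$. The $i$-th homology is $H_i(X_\bullet)=(X_i/\bar X_{i+1})\backslash\bar X_i\cong(X_i\backslash\bar X_i)/\bar X_{i+1}$ (the two are canonically isomorphic). $X_\bullet$ is exact if $H_i(X_\bullet)=\varnothing$ for all $i$, equivalently each $\bar X_{i+1}\rightarrowtail X_i\dashleftarrow\bar X_i$ is a kernel-cokernel pair. Morphisms. A morphism $f_\bullet:X_\bullet\to Y_\bullet$ of chain complexes is a sequence of morphisms $f_i: X_i\dashleftarrow Z_i\rightarrowtail Y_i$ in $\mathbb A^\flat$ such that for each $i$ there is an object $\bar Z_i$ with a span $Z_i\dashleftarrow\bar Z_i\rightarrowtail Z_{i-1}$ and morphisms $\bar Z_i\dashrightarrow\bar X_i$, $\bar Z_i\rightarrowtail\bar Y_i$ making the two evident one-type squares (vertical: $\bar Z_i,Z_i,\bar X_i,X_i$; horizontal: $\bar Z_i,Z_{i-1},\bar Y_i,Y_{i-1}$) commutative and the two evident mixed squares ($\bar Z_i\rightarrowtail Z_{i-1}$ over $\bar X_i\rightarrowtail X_{i-1}$; $\bar Z_i\rightarrowtail\bar Y_i$ over $Z_i\rightarrowtail Y_i$) pseudo-commutative. Equivalently, $d^Yf=fd^X$ in $\mathbb A^\flat$. These form the category $\mathrm{Ch}_{\mathbb A}$. A horizontal morphism of complexes $X_\bullet\rightarrowtail Y_\bullet$ is a sequence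 $X_i\rightarrowtail Y_i$ for which there exist $\bar X_i\rightarrowtail\bar Y_i$ such that the square with horizontal sides $\bar X_i\rightarrowtail\bar Y_i$, $X_i\rightarrowtail Y_i$ and vertical sides $\bar X_i\dashrightarrow X_i$, $\bar Y_i\dashrightarrow Y_i$ is pseudo-commutative and the square of horizontal morphisms on $\bar X_i,X_{i-1},\bar Y_i,Y_{i-1}$ commutes. A vertical morphism of complexes $Z_\bullet\dashrightarrow Y_\bullet$ is a sequence $Z_i\dashrightarrow Y_i$ for which there exist $\bar Z_i\dashrightarrow\bar Y_i$ such that the square of vertical morphisms on $\bar Z_i,Z_i,\bar Y_i,Y_i$ commutes and the square with horizontal sides $\bar Z_i\rightarrowtail Z_{i-1}$, $\bar Y_i\rightarrowtail Y_{i-1}$ and vertical sides $\bar Z_i\dashrightarrow\bar Y_i$, $Z_{i-1}\dashrightarrow Y_{i-1}$ is pseudo-commutative. With squares the levelwise pseudo-commutative ones (at each $i$ and at each barred object), complexes with these morphisms form an ACGW category $\mathbb{C}\mathrm{h}_{\mathbb A}$. A horizontal morphism $X_\bullet\rightarrowtail Y_\bullet$ is regarded as the chain morphism $X_\bullet=X_\bullet\rightarrowtail Y_\bullet$, a vertical morphism $Z_\bullet\dashrightarrow Y_\bullet$ as the chain morphism $Y_\bullet\dashleftarrow Z_\bullet=Z_\bullet$ from $Y_\bullet$ to $Z_\bullet$, and every chain morphism is a composite $X_\bullet\dashleftarrow Z_\bullet\rightarrowtail Y_\bullet$ of the two kinds. Short exact sequences of complexes. These are pairs $X_\bullet\rightarrowtail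 Y_\bullet\dashleftarrow Z_\bullet$ of a horizontal and a vertical morphism of complexes with each $X_i\rightarrowtail Y_i\dashleftarrow Z_i$ a kernel-cokernel pair; then $Z_\bullet=Y_\bullet/X_\bullet$ is the cokernel of $X_\bullet\rightarrowtail Y_\bullet$ (one has $Z_i=Y_i/X_i$ and $\bar Z_i=\bar Y_i\oslash_{Y_{i-1}}Z_{i-1}$). Induced morphisms on homology. For horizontal $X_\bullet\rightarrowtail Y_\bullet$, let $P_{i+1}=X_i\times_{Y_i}\bar Y_{i+1}$ (pullback of horizontal morphisms). Then $\bar X_{i+1}\rightarrowtail P_{i+1}\rightarrowtail X_i$ and $\bar X_i\oslash$-intersects $P_{i+1}$ in $\varnothing$ (inside $X_i$), giving $\bar X_i\dashrightarrow X_i/P_{i+1}\dashrightarrow X_i/\bar X_{i+1}$ and $X_i/P_{i+1}\rightarrowtail Y_i/\bar Y_{i+1}$. The induced morphism is the span $H_i(X_\bullet)\dashleftarrow (X_i/P_{i+1})\backslash\bar X_i\rightarrowtail H_i(Y_\bullet)$ of induced maps on kernels. Dually, for vertical $Z_\bullet\dashrightarrow Y_\bullet$, let $Q_i=Z_i\times_{Y_i}\bar Y_i$ (pullback of vertical morphisms); the induced morphism $H_i(Y_\bullet)\to H_i(Z_\bullet)$ is the span $H_i(Y_\bullet)\dashleftarrow (Z_i\backslash Q_i)/\bar Z_{i+1}\rightarrowtail H_i(Z_\bullet)$ of induced maps on cokernels. For a general chain morphism $X_\bullet\dashleftarrow Z_\bullet\rightarrowtail Y_\bullet$, $H_i(f_\bullet)$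 is the composite in $\mathbb A^\flat$ of $H_i(X_\bullet)\to H_i(Z_\bullet)$ and $H_i(Z_\bullet)\to H_i(Y_\bullet)$. *)

(* Defs.v *)
From Stdlib Require Import ZArith IndefiniteDescription Setoid.

Set Implicit Arguments.
Unset Strict Implicit.
Unset Printing Implicit Defensive.

(** * Double categories

    A square is determined by its boundary, so squares are a predicate [sq top
    bottom left right] on boundaries and interchange is automatic.
    Compositions are written in diagrammatic order: in [f ;h g] and [u ;v w],
    the left factor is applied first. *)

Record DoubleCategory : Type := {
  ob :> Type;
  hor : ob -> ob -> Type;
  ver : ob -> ob -> Type;
  hid : forall A, hor A A;
  vid : forall A, ver A A;
  hcomp : forall A B C, hor A B -> hor B C -> hor A C;
  vcomp : forall A B C, ver A B -> ver B C -> ver A C;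
  hcomp_id_l : forall A B (f : hor A B), hcomp (hid A) f = f;
  hcomp_id_r : forall A B (f : hor A B), hcomp f (hid B) = f;
  hcomp_assoc : forall A B C D (f : hor A B) (g : hor B C) (h : hor C D),
    hcomp (hcomp f g) h = hcomp f (hcomp g h);
  vcomp_id_l : forall A B (u : ver A B), vcomp (vid A) u = u;
  vcomp_id_r : forall A B (u : ver A B), vcomp u (vid B) = u;
  vcomp_assoc : forall A B C D (u : ver A B) (v : ver B C) (w : ver C D),
    vcomp (vcomp u v) w = vcomp u (vcomp v w);
  sq : forall A B C D, hor A B -> hor C D -> ver A C -> ver B D -> Prop;
  sq_hid : forall A C (u : ver A C), sq (hid A) (hid C) u u;
  sq_vid : forall A B (f : hor A B), sq f f (vid A) (vid B);
  sq_hcomp : forall A B B' C D D' (f : hor A B) (f' : hor B B')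
      (g : hor C D) (g' : hor D D') (u : ver A C) (v : ver B D) (w : ver B' D'),
    sq f g u v -> sq f' g' v w -> sq (hcomp f f') (hcomp g g') u w;
  sq_vcomp : forall A B C D E F (f : hor A B) (g : hor C D) (h : hor E F)
      (u : ver A C) (v : ver B D) (u' : ver C E) (v' : ver D F),
    sq f g u v -> sq g h u' v' -> sq f h (vcomp u u') (vcomp v v')
}.

Arguments hid {_} A.
Arguments vid {_} A.

Notation "f ;h g" := (hcomp f g) (at level 45, left associativity).
Notation "u ;v w" := (vcomp u w) (at level 45, left associativity).

Section DoubleCategoryNotions.
Context {D : DoubleCategory}.

Definition is_hiso {A B : D} (f : hor A B) : Prop :=
  exists g : hor B A, f ;h g = hid A /\ g ;h f = hid B.

Definition is_viso {A B : D} (u : ver A B) : Prop :=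
  exists w : ver B A, u ;v w = vid A /\ w ;v u = vid B.

(** Isomorphism of two morphisms with the same target, over that target. *)
Definition hiso_over {A A' B : D} (f : hor A B) (f' : hor A' B) : Prop :=
  exists e : hor A A', is_hiso e /\ e ;h f' = f.

Definition viso_over {A A' B : D} (u : ver A B) (u' : ver A' B) : Prop :=
  exists e : ver A A', is_viso e /\ e ;v u' = u.

(** [p, q] exhibit [P] as the pullback of [f, g]. *)
Definition h_pullback {P A B C : D}
    (p : hor P A) (q : hor P B) (f : hor A C) (g : hor B C) : Prop :=
  p ;h f = q ;h g /\
  forall (E : D) (a : hor E A) (b : hor E B), a ;h f = b ;h g ->
    exists! t : hor E P, t ;h p = a /\ t ;h q = b.

Definition v_pullback {P A B C : D}
    (p : ver P A) (q : ver P B) (u : ver A C) (w : ver B C) : Prop :=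
  p ;v u = q ;v w /\
  forall (E : D) (a : ver E A) (b : ver E B), a ;v u = b ;v w ->
    exists! t : ver E P, t ;v p = a /\ t ;v q = b.

End DoubleCategoryNotions.

(** * ACGW categories *)

Record ACGW : Type := {
  dc :> DoubleCategory;

  empty : dc;
  hinit : forall B : dc, hor empty B;
  vinit : forall B : dc, ver empty B;
  hinit_unique : forall (B : dc) (f : hor empty B), f = hinit B;
  vinit_unique : forall (B : dc) (u : ver empty B), u = vinit B;
  hmonic : forall (A B C : dc) (f f' : hor A B) (g : hor B C),
    f ;h g = f' ;h g -> f = f';
  vmonic : forall (A B C : dc) (u u' : ver A B) (w : ver B C),
    u ;v w = u' ;v w -> u = u';
  (** [same f u]: the horizontal isomorphism [f] and the vertical isomorphism
      [u] are identified.  It is the graph of a bijection. *)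
  same : forall A B : dc, hor A B -> ver A B -> Prop;
  same_hiso : forall (A B : dc) (f : hor A B) (u : ver A B),
    same f u -> is_hiso f;
  same_viso : forall (A B : dc) (f : hor A B) (u : ver A B),
    same f u -> is_viso u;
  same_of_h : forall (A B : dc) (f : hor A B), is_hiso f -> exists! u, same f u;
  same_of_v : forall (A B : dc) (u : ver A B), is_viso u -> exists! f, same f u;
  same_id : forall A : dc, same (hid A) (vid A);
  same_comp : forall (A B C : dc) (f : hor A B) (u : ver A B)
      (g : hor B C) (w : ver B C),
    same f u -> same g w -> same (f ;h g) (u ;v w);
  sq_hiso : forall (A B C D : dc) (f : hor A B) (g : hor C D)
      (u : ver A C) (v : ver B D) (f' : ver A B) (g' : ver C D),
    same f f' -> same g g' -> (sq f g u v <-> f' ;v v = u ;v g');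
  sq_viso : forall (A B C D : dc) (f : hor A B) (g : hor C D)
      (u : ver A C) (v : ver B D) (u' : hor A C) (v' : hor B D),
    same u' u -> same v' v -> (sq f g u v <-> f ;h v' = u' ;h g);

  (** [cok f] is the object B/A with its vertical morphism [coker f];
      [kern u] is the object B\A with its horizontal morphism [ker u]. *)
  cok : forall A B : dc, hor A B -> dc;
  coker : forall (A B : dc) (f : hor A B), ver (cok f) B;
  kern : forall A B : dc, ver A B -> dc;
  ker : forall (A B : dc) (u : ver A B), hor (kern u) B;
  coker_iso : forall (A A' B : dc) (f : hor A B) (f' : hor A' B),
    hiso_over f f' -> viso_over (coker f) (coker f');
  ker_iso : forall (A A' B : dc) (u : ver A B) (u' : ver A' B),
    viso_over u u' -> hiso_over (ker u) (ker u');
  ker_coker : forall (A B : dc) (f : hor A B), hiso_over (ker (coker f)) f;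
  coker_ker : forall (A B : dc) (u : ver A B), viso_over (coker (ker u)) u;
  (** A ⊘_B (B/A) is empty: [f] followed by its cokernel is zero.  The other
      fields do not imply this: finite sets with hor = ver = injections,
      pullback squares, and [coker], [ker] the identity satisfy them. *)
  sq_coker : forall (A B : dc) (f : hor A B),
    sq (hinit (cok f)) f (vinit A) (coker f);

  (** [coker] and [ker] are equivalences from the categories of horizontal,
      resp. vertical, morphisms and pseudo-commutative squares to those of
      vertical, resp. horizontal, morphisms and pullback squares: [_sq] is the
      action on morphisms (functorial because the induced side is unique by
      monicity), [_ff] is full faithfulness; essential surjectivity is [coker_ker] and
      [ker_coker]. *)
  coker_sq : forall (A B C D : dc) (f : hor A B) (g : hor C D)
      (u : ver A C) (v : ver B D), sq f g u v ->
    exists w : ver (cok f) (cok g), v_pullback (coker f) w v (coker g);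
  coker_ff : forall (A B C D : dc) (f : hor A B) (g : hor C D)
      (v : ver B D) (w : ver (cok f) (cok g)),
    v_pullback (coker f) w v (coker g) -> exists! u : ver A C, sq f g u v;
  ker_sq : forall (A B C D : dc) (f : hor A B) (g : hor C D)
      (u : ver A C) (v : ver B D), sq f g u v ->
    exists m : hor (kern u) (kern v), h_pullback (ker u) m g (ker v);
  ker_ff : forall (A B C D : dc) (g : hor C D)
      (u : ver A C) (v : ver B D) (m : hor (kern u) (kern v)),
    h_pullback (ker u) m g (ker v) -> exists! f : hor A B, sq f g u v;

  (** [mix f v] is the corner A ⊘_C B. *)
  mix : forall A B C : dc, hor A C -> ver B C -> dc;
  mix_top : forall (A B C : dc) (f : hor A C) (v : ver B C), hor (mix f v) B;
  mix_left : forall (A B C : dc) (f : hor A C) (v : ver B C), ver (mix f v) A;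
  mix_sq : forall (A B C : dc) (f : hor A C) (v : ver B C),
    sq (mix_top f v) f (mix_left f v) v;
  mix_unique : forall (A B C : dc) (f : hor A C) (v : ver B C)
      (E : dc) (t : hor E B) (l : ver E A), sq t f l v ->
    exists! e : hor E (mix f v), exists e' : ver E (mix f v),
      same e e' /\ e ;h mix_top f v = t /\ e' ;v mix_left f v = l
}.

Arguments empty A : rename.
Arguments hinit {_} B.
Arguments vinit {_} B.
Arguments cok {_ A B} f.
Arguments coker {_ A B} f.
Arguments kern {_ A B} u.
Arguments ker {_ A B} u.
Arguments mix {_ A B C} f v.
Arguments mix_top {_ A B C} f v.
Arguments mix_left {_ A B C} f v.

Section ACGWNotions.
Context {A : ACGW}.

Definition is_empty (E : A) : Prop := is_hiso (hinit E).

Definition ker_coker_pair {B C E : A} (f : hor B C) (u : ver E C) : Prop :=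
  hiso_over f (ker u).

(** Two adjacent differentials X <-- V >--> .. and .. <-- U >--> X compose to
    zero: U ⊘_X V is empty. *)
Definition zero_at {U X V : A} (h : hor U X) (v : ver V X) : Prop :=
  is_empty (mix h v).

(** ** Isomorphisms *)

Lemma same_inv (B C : A) (f : hor B C) (u : ver B C) : same f u ->
  exists (g : hor C B) (w : ver C B), same g w /\
    f ;h g = hid B /\ g ;h f = hid C /\ u ;v w = vid B /\ w ;v u = vid C.
Proof.
intros H; destruct (same_hiso H) as [g [fg gf]].
destruct (same_of_h (f := g)) as [w [Hw _]]; [now exists f|].
exists g, w; repeat split; trivial.
- destruct (same_of_h (f := hid B)) as [x [_ Hx]].
  { exists (hid B); split; apply hcomp_id_l. }
  rewrite <- (Hx (vid B) (same_id B)); symmetry; apply Hx.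
  rewrite <- fg; now apply same_comp.
- destruct (same_of_h (f := hid C)) as [x [_ Hx]].
  { exists (hid C); split; apply hcomp_id_l. }
  rewrite <- (Hx (vid C) (same_id C)); symmetry; apply Hx.
  rewrite <- gf; now apply same_comp.
Qed.

Lemma mix_unique2 (B C E : A) (f : hor B E) (v : ver C E)
    (S T : A) (t1 : hor S C) (l1 : ver S B) (t2 : hor T C) (l2 : ver T B) :
  sq t1 f l1 v -> sq t2 f l2 v ->
  exists (e : hor S T) (e' : ver S T),
    same e e' /\ e ;h t2 = t1 /\ e' ;v l2 = l1.
Proof.
intros H1 H2.
destruct (mix_unique H1) as [a [[a' [Ha [Ha1 Ha2]]] _]].
destruct (mix_unique H2) as [b [[b' [Hb [Hb1 Hb2]]] _]].
destruct (same_inv Hb) as [c [c' [Hc [_ [cb [_ cb']]]]]].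
exists (a ;h c), (a' ;v c'); split; [now apply same_comp|split].
- now rewrite <- Hb1, hcomp_assoc, <- (hcomp_assoc c), cb, hcomp_id_l.
- now rewrite <- Hb2, vcomp_assoc, <- (vcomp_assoc c'), cb', vcomp_id_l.
Qed.

Lemma coker_hinit (V : A) : is_viso (coker (hinit V)).
Proof.
destruct (coker_ker (vid V)) as [e [He Hee]].
rewrite vcomp_id_r in Hee; subst e.
destruct (same_of_v He) as [f [Hf _]].
destruct (same_inv Hf) as [g [w [Hg [_ [_ [_ ww]]]]]].
assert (S1 : sq (hinit V) (hinit (cok (ker (vid V)))) (vid (empty A)) w).
{ apply (proj2 (sq_viso _ _ (same_id (empty A)) Hg)).
  rewrite (hinit_unique (_ ;h g)), hcomp_id_l; reflexivity. }
pose proof (sq_vcomp S1 (sq_coker (ker (vid V)))) as S2.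
rewrite ww in S2.
destruct (coker_sq S2) as [x [Hx Hu]].
destruct He as [y [_ Hy]].
destruct (Hu V (vid V) y) as [t [[Ht _] _]].
{ now rewrite vcomp_id_l, Hy. }
exists t; split; trivial.
apply (vmonic (w := coker (hinit V))).
now rewrite vcomp_assoc, Ht, vcomp_id_r, vcomp_id_l.
Qed.

Lemma ker_vinit (U : A) : is_hiso (ker (vinit U)).
Proof.
destruct (ker_sq (sq_coker (hid U))) as [m [Hm Hu]].
destruct (ker_coker (hid U)) as [e [He Hee]].
rewrite hcomp_id_r in Hee; subst e.
destruct He as [y [_ Hy]].
destruct (Hu U (hid U) y) as [t [[Ht _] _]].
{ now rewrite hcomp_id_l, Hy. }
exists t; split; trivial.
apply (hmonic (g := ker (vinit U))).
now rewrite hcomp_assoc, Ht, hcomp_id_r, hcomp_id_l.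
Qed.

Lemma zero_at_sq (U X V : A) (h : hor U X) (v : ver V X) :
  zero_at h v -> sq (hinit V) h (vinit U) v.
Proof.
intros Z; destruct (same_of_h Z) as [z [Hz _]].
assert (S1 : sq (hinit V) (mix_top h v) (vid (empty A) ;v z) (vid V)).
{ apply (proj2 (sq_viso _ _ (same_comp (same_id _) Hz) (same_id V))).
  now rewrite (hinit_unique (hinit V ;h hid V)),
    (hinit_unique (_ ;h mix_top h v)). }
pose proof (sq_vcomp S1 (mix_sq h v)) as S2.
now rewrite !vcomp_id_l, (vinit_unique (_ ;v mix_left h v)) in S2.
Qed.

Lemma to_coker_ex (U X V : A) (h : hor U X) (v : ver V X) : zero_at h v ->
  exists q : ver V (cok h), q ;v coker h = v.
Proof.
intros Z; destruct (coker_sq (zero_at_sq Z)) as [w [Hw _]].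
destruct (coker_hinit V) as [t [_ Ht]].
exists (t ;v w).
now rewrite vcomp_assoc, <- Hw, <- vcomp_assoc, Ht, vcomp_id_l.
Qed.

Lemma to_ker_ex (U X V : A) (h : hor U X) (v : ver V X) : zero_at h v ->
  exists j : hor U (kern v), j ;h ker v = h.
Proof.
intros Z; destruct (ker_sq (zero_at_sq Z)) as [m [Hm _]].
destruct (ker_vinit U) as [t [_ Ht]].
exists (t ;h m).
now rewrite hcomp_assoc, <- Hm, <- hcomp_assoc, Ht, hcomp_id_l.
Qed.

(** For h : U >--> X and v : V --> X with U ⊘_X V empty, the induced
    V --> X/U and U >--> X\V; both are unique by monicity. *)
Definition to_coker {U X V : A} {h : hor U X} {v : ver V X} (z : zero_at h v) :
    ver V (cok h) :=
  proj1_sig (constructive_indefinite_description _ (to_coker_ex z)).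

Definition to_ker {U X V : A} {h : hor U X} {v : ver V X} (z : zero_at h v) :
    hor U (kern v) :=
  proj1_sig (constructive_indefinite_description _ (to_ker_ex z)).

Lemma to_cokerE (U X V : A) (h : hor U X) (v : ver V X) (z : zero_at h v) :
  to_coker z ;v coker h = v.
Proof.
exact (proj2_sig (constructive_indefinite_description _ (to_coker_ex z))).
Qed.

Lemma to_kerE (U X V : A) (h : hor U X) (v : ver V X) (z : zero_at h v) :
  to_ker z ;h ker v = h.
Proof.
exact (proj2_sig (constructive_indefinite_description _ (to_ker_ex z))).
Qed.

(** * Flattening *)

Record Span (B C : A) : Type := MkSpan {
  mid : A;
  lleg : ver mid B;
  rleg : hor mid C
}.

Definition span_eq {B C : A} (s t : Span B C) : Prop :=
  exists (e : hor (mid s) (mid t)) (e' : ver (mid s) (mid t)),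
    same e e' /\ e' ;v lleg t = lleg s /\ e ;h rleg t = rleg s.

Definition span_id (B : A) : Span B B := MkSpan (vid B) (hid B).

Definition span_comp {B C E : A} (s : Span B C) (t : Span C E) : Span B E :=
  MkSpan (mix_left (rleg s) (lleg t) ;v lleg s)
         (mix_top (rleg s) (lleg t) ;h rleg t).

Lemma span_eq_refl (B C : A) (s : Span B C) : span_eq s s.
Proof.
exists (hid _), (vid _); split; [apply same_id|].
split; [apply vcomp_id_l|apply hcomp_id_l].
Qed.

Lemma span_eq_sym (B C : A) (s t : Span B C) : span_eq s t -> span_eq t s.
Proof.
intros [e [e' [H [Hl Hr]]]].
destruct (same_inv H) as [g [w [Hg [_ [gf [_ wf]]]]]].
exists g, w; split; trivial; split.
- now rewrite <- Hl, <- vcomp_assoc, wf, vcomp_id_l.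
- now rewrite <- Hr, <- hcomp_assoc, gf, hcomp_id_l.
Qed.

Lemma span_eq_trans (B C : A) (s t r : Span B C) :
  span_eq s t -> span_eq t r -> span_eq s r.
Proof.
intros [e [e' [H [Hl Hr]]]] [g [g' [K [Kl Kr]]]].
exists (e ;h g), (e' ;v g'); split; [now apply same_comp|split].
- now rewrite vcomp_assoc, Kl.
- now rewrite hcomp_assoc, Kr.
Qed.

(** Any corner computes the composite span. *)
Lemma span_comp_corner (B C E : A) (s : Span B C) (t : Span C E)
    (R : A) (a : hor R (mid t)) (b : ver R (mid s)) :
  sq a (rleg s) b (lleg t) ->
  span_eq (MkSpan (b ;v lleg s) (a ;h rleg t)) (span_comp s t).
Proof.
intros H; destruct (mix_unique2 H (mix_sq _ _)) as [e [e' [He [Ht Hl]]]].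
exists e, e'; simpl; split; trivial; split.
- now rewrite <- vcomp_assoc, Hl.
- now rewrite <- hcomp_assoc, Ht.
Qed.

Lemma span_comp_eq (B C E : A) (s s' : Span B C) (t t' : Span C E) :
  span_eq s s' -> span_eq t t' -> span_eq (span_comp s t) (span_comp s' t').
Proof.
intros [e [e' [H [Hl Hr]]]] [g [g' [K [Kl Kr]]]].
assert (S1 : sq (rleg s) (rleg s') e' (vid C)).
{ apply (proj2 (sq_viso _ _ H (same_id C))); now rewrite hcomp_id_r, Hr. }
assert (S2 : sq g (hid C) (lleg t) (lleg t')).
{ apply (proj2 (sq_hiso _ _ K (same_id C))); now rewrite vcomp_id_r, Kl. }
pose proof (sq_vcomp (mix_sq (rleg s) (lleg t)) S1) as S3.
rewrite vcomp_id_r in S3.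
pose proof (sq_hcomp S3 S2) as S4; rewrite hcomp_id_r in S4.
destruct (span_comp_corner S4) as [x [x' [X [Xl Xr]]]].
exists x, x'; simpl in *; split; trivial; split.
- now rewrite Xl, vcomp_assoc, Hl.
- now rewrite Xr, hcomp_assoc, Kr.
Qed.

Lemma span_comp_id_l (B C : A) (s : Span B C) :
  span_eq (span_comp (span_id B) s) s.
Proof.
apply span_eq_sym.
destruct (@span_comp_corner _ _ _ (span_id B) s _ (hid _) (lleg s) (sq_hid _))
  as [x [x' [X [Xl Xr]]]].
exists x, x'; simpl in *; split; trivial; split.
- now rewrite Xl, vcomp_id_r.
- now rewrite Xr, hcomp_id_l.
Qed.

Lemma span_comp_id_r (B C : A) (s : Span B C) :
  span_eq (span_comp s (span_id C)) s.
Proof.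
apply span_eq_sym.
destruct (@span_comp_corner _ _ _ s (span_id C) _ (rleg s) (vid _) (sq_vid _))
  as [x [x' [X [Xl Xr]]]].
exists x, x'; simpl in *; split; trivial; split.
- now rewrite Xl, vcomp_id_l.
- now rewrite Xr, hcomp_id_r.
Qed.

Lemma span_comp_assoc (B C E F : A)
    (s : Span B C) (t : Span C E) (r : Span E F) :
  span_eq (span_comp (span_comp s t) r) (span_comp s (span_comp t r)).
Proof.
set (m1 := mix_top (rleg s) (lleg t)).
set (m2 := mix_left (rleg t) (lleg r)).
pose proof (mix_sq m1 m2) as R.
apply span_eq_trans with
  (MkSpan (mix_left m1 m2 ;v (mix_left (rleg s) (lleg t) ;v lleg s))
          (mix_top m1 m2 ;h (mix_top (rleg t) (lleg r) ;h rleg r))).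
- apply span_eq_sym.
  destruct (@span_comp_corner _ _ _ (span_comp s t) r _ _ _
    (sq_hcomp R (mix_sq (rleg t) (lleg r)))) as [x [x' [X [Xl Xr]]]].
  exists x, x'; simpl in *; split; trivial; split; trivial.
  now rewrite Xr, hcomp_assoc.
- destruct (@span_comp_corner _ _ _ s (span_comp t r) _ _ _
    (sq_vcomp R (mix_sq (rleg s) (lleg t)))) as [x [x' [X [Xl Xr]]]].
  exists x, x'; simpl in *; split; trivial; split; trivial.
  now rewrite Xl, vcomp_assoc.
Qed.

End ACGWNotions.

(** * Categories and functors

    Equality of morphisms is a given equivalence relation: morphisms of A^flat
    are spans up to isomorphism. *)

Record Category : Type := {
  cat_ob :> Type;
  cat_hom : cat_ob -> cat_ob -> Type;
  cat_eq : forall a b, cat_hom a b -> cat_hom a b -> Prop;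
  cat_id : forall a, cat_hom a a;
  cat_comp : forall a b c, cat_hom a b -> cat_hom b c -> cat_hom a c;
  cat_eq_refl : forall a b (f : cat_hom a b), cat_eq f f;
  cat_eq_sym : forall a b (f g : cat_hom a b), cat_eq f g -> cat_eq g f;
  cat_eq_trans : forall a b (f g h : cat_hom a b),
    cat_eq f g -> cat_eq g h -> cat_eq f h;
  cat_comp_eq : forall a b c (f f' : cat_hom a b) (g g' : cat_hom b c),
    cat_eq f f' -> cat_eq g g' -> cat_eq (cat_comp f g) (cat_comp f' g');
  cat_comp_id_l : forall a b (f : cat_hom a b), cat_eq (cat_comp (cat_id a) f) f;
  cat_comp_id_r : forall a b (f : cat_hom a b), cat_eq (cat_comp f (cat_id b)) f;
  cat_comp_assoc : forall a b c d
      (f : cat_hom a b) (g : cat_hom b c) (h : cat_hom c d),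
    cat_eq (cat_comp (cat_comp f g) h) (cat_comp f (cat_comp g h))
}.

Arguments cat_id {_} a.

(** Functors with a prescribed action on objects. *)
Record FunctorOn (C D : Category) (F : C -> D) : Type := {
  fmap : forall a b : C, cat_hom a b -> cat_hom (F a) (F b);
  fmap_eq : forall (a b : C) (f g : cat_hom a b),
    cat_eq f g -> cat_eq (fmap f) (fmap g);
  fmap_id : forall a : C, cat_eq (fmap (cat_id a)) (cat_id (F a));
  fmap_comp : forall (a b c : C) (f : cat_hom a b) (g : cat_hom b c),
    cat_eq (fmap (cat_comp f g)) (cat_comp (fmap f) (fmap g))
}.

Definition Flat (A : ACGW) : Category := {|
  cat_ob := A;
  cat_hom := @Span A;
  cat_eq := @span_eq A;
  cat_id := @span_id A;
  cat_comp := @span_comp A;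
  cat_eq_refl := @span_eq_refl A;
  cat_eq_sym := @span_eq_sym A;
  cat_eq_trans := @span_eq_trans A;
  cat_comp_eq := @span_comp_eq A;
  cat_comp_id_l := @span_comp_id_l A;
  cat_comp_id_r := @span_comp_id_r A;
  cat_comp_assoc := @span_comp_assoc A
|}.

(** * Chain complexes

    Complexes are indexed by a type [I] with a successor [s] ([Z] and [Z.succ]
    for Ch_A; another copy of the integers for the long exact sequence).  The
    differential X_{i+1} -> X_i is the span of [dver (s i)] and [dhor i];
    attaching the horizontal leg to its target avoids casts along i - 1 + 1 = i. *)

Record Differentials (A : ACGW) (I : Type) (s : I -> I) (X : I -> A) : Type := {
  dbar : I -> A;
  dver : forall i, ver (dbar i) (X i);
  dhor : forall i, hor (dbar (s i)) (X i)
}.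

Record Complex (A : ACGW) (I : Type) (s : I -> I) : Type := MkComplex {
  cob :> I -> A;
  cdiff : Differentials s cob;
  czero : forall i, zero_at (dhor cdiff i) (dver cdiff i)
}.

Arguments MkComplex {A I s cob} cdiff czero.

Section Complexes.
Context {A : ACGW} {I : Type} {s : I -> I}.
Implicit Types X Y Z : Complex A s.

Definition bar X (i : I) : A := dbar (cdiff X) i.
Definition vleg X (i : I) : ver (bar X i) (X i) := dver (cdiff X) i.
Definition hleg X (i : I) : hor (bar X (s i)) (X i) := dhor (cdiff X) i.

Definition diff X (i : I) : Span (X (s i)) (X i) :=
  MkSpan (vleg X (s i)) (hleg X i).

(** Xbar_i --> X_i/Xbar_{i+1} and Xbar_{i+1} >--> X_i\Xbar_i. *)
Definition vbar X (i : I) : ver (bar X i) (cok (hleg X i)) :=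
  to_coker (czero X i).
Definition hbar X (i : I) : hor (bar X (s i)) (kern (vleg X i)) :=
  to_ker (czero X i).

(** The two descriptions of H_i. *)
Definition homology (i : I) X : A := kern (vbar X i).
Definition homology' (i : I) X : A := cok (hbar X i).

(** The canonical isomorphism [homology i X] = [homology' i X], as a pair of
    identified horizontal and vertical isomorphisms: it makes H_i the corner
    of X_i\Xbar_i >--> X_i <-- X_i/Xbar_{i+1}, which determines it. *)
Definition homology_comparison X (i : I)
    (e : hor (homology i X) (homology' i X))
    (e' : ver (homology i X) (homology' i X)) : Prop :=
  same e e' /\
  sq (ker (vbar X i)) (ker (vleg X i)) (e' ;v coker (hbar X i))
     (coker (hleg X i)).

Definition exact X : Prop := forall i, is_empty (homology i X).

(** ** Morphisms of complexes *)

(** The condition on a pair f_{i+1}, f_i of components; [zb] is Zbar_{i+1}. *)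
Definition chain_square X Y (i : I)
    (f1 : Span (X (s i)) (Y (s i))) (f0 : Span (X i) (Y i)) : Prop :=
  exists (zb : A) (v : ver zb (mid f1)) (h : hor zb (mid f0))
      (x : ver zb (bar X (s i))) (y : hor zb (bar Y (s i))),
    v ;v lleg f1 = x ;v vleg X (s i) /\
    h ;h rleg f0 = y ;h hleg Y i /\
    sq h (hleg X i) x (lleg f0) /\
    sq y (rleg f1) v (vleg Y (s i)).

Record ChainMap X Y : Type := MkChainMap {
  component :> forall i, Span (X i) (Y i);
  component_chain : forall i, chain_square (component (s i)) (component i)
}.

Record HorMap X Y : Type := {
  hmap :> forall i, hor (X i) (Y i);
  hmap_chain : exists hb : forall i, hor (bar X i) (bar Y i), forall i,
    sq (hb i) (hmap i) (vleg X i) (vleg Y i) /\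
    hb (s i) ;h hleg Y i = hleg X i ;h hmap i
}.

Record VerMap X Y : Type := {
  vmap :> forall i, ver (X i) (Y i);
  vmap_chain : exists vb : forall i, ver (bar X i) (bar Y i), forall i,
    vb i ;v vleg Y i = vleg X i ;v vmap i /\
    sq (hleg X i) (hleg Y i) (vb (s i)) (vmap i)
}.

(** X >--> Y <-- Z *)
Definition short_exact X Y Z (F : HorMap X Y) (G : VerMap Z Y) : Prop :=
  forall i, ker_coker_pair (F i) (G i).

Lemma chain_squareP X Y (i : I)
    (f1 : Span (X (s i)) (Y (s i))) (f0 : Span (X i) (Y i)) :
  chain_square f1 f0 <->
  span_eq (span_comp f1 (diff Y i)) (span_comp (diff X i) f0).
Proof.
split.
- intros [zb [v [h [x [y [E1 [E2 [S1 S2]]]]]]]].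
  apply span_eq_trans with (MkSpan (v ;v lleg f1) (y ;h hleg Y i)).
  + apply span_eq_sym.
    exact (@span_comp_corner _ _ _ _ f1 (diff Y i) _ _ _ S2).
  + rewrite E1, <- E2.
    exact (@span_comp_corner _ _ _ _ (diff X i) f0 _ _ _ S1).
- intros [e [e' [H [Hl Hr]]]]; simpl in *.
  set (S1 := mix_sq (hleg X i) (lleg f0)).
  exists (mix (rleg f1) (vleg Y (s i))), (mix_left _ _),
    (e ;h mix_top _ _), (e' ;v mix_left _ _), (mix_top _ _).
  split; [now rewrite vcomp_assoc, Hl|split; [now rewrite hcomp_assoc, Hr|]].
  split; [|apply mix_sq].
  assert (S2 : sq (e ;h mix_top (hleg X i) (lleg f0))
                  (mix_top (hleg X i) (lleg f0)) e' (vid _)).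
  { apply (proj2 (sq_viso _ _ H (same_id _))); now rewrite hcomp_id_r. }
  pose proof (sq_vcomp S2 S1) as S3; now rewrite vcomp_id_l in S3.
Qed.

Definition chain_eq X Y (f g : ChainMap X Y) : Prop :=
  forall i, span_eq (f i) (g i).

Lemma chain_id_square X (i : I) :
  chain_square (span_id (X (s i))) (span_id (X i)).
Proof.
apply chain_squareP; eapply span_eq_trans; [apply span_comp_id_l|].
apply span_eq_sym, span_comp_id_r.
Qed.

Definition chain_id X : ChainMap X X :=
  MkChainMap (component := fun i => span_id (X i)) (chain_id_square X).

Lemma chain_comp_square X Y Z (f : ChainMap X Y) (g : ChainMap Y Z) (i : I) :
  chain_square (span_comp (f (s i)) (g (s i))) (span_comp (f i) (g i)).
Proof.
apply chain_squareP.
pose proof (proj1 (chain_squareP _ _) (component_chain f i)) as Hf.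
pose proof (proj1 (chain_squareP _ _) (component_chain g i)) as Hg.
eapply span_eq_trans; [apply span_comp_assoc|].
eapply span_eq_trans; [apply span_comp_eq; [apply span_eq_refl|exact Hg]|].
eapply span_eq_trans; [apply span_eq_sym, span_comp_assoc|].
eapply span_eq_trans; [apply span_comp_eq; [exact Hf|apply span_eq_refl]|].
apply span_comp_assoc.
Qed.

Definition chain_comp X Y Z (f : ChainMap X Y) (g : ChainMap Y Z) :
    ChainMap X Z :=
  MkChainMap (component := fun i => span_comp (f i) (g i))
    (chain_comp_square f g).

(** ** Induced morphisms on homology

    Each predicate determines the span [t] up to isomorphism, all the auxiliary
    morphisms being unique by monicity and full
    faithfulness. *)

(** [m] is X_i/P >--> Y_i/Ybar_{i+1}; [a] and [b] are the induced maps
    H_i(X) <-- (X_i/P)\Xbar_i >--> H_i(Y) on kernels. *)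
Definition induced_hor X Y (F : HorMap X Y) (i : I)
    (t : Span (homology i X) (homology i Y)) : Prop :=
  exists (P : A) (p : hor P (X i)) (p' : hor P (bar Y (s i))),
    h_pullback p p' (F i) (hleg Y i) /\
  exists (q : ver (bar X i) (cok p)) (r : ver (cok p) (cok (hleg X i)))
      (m : hor (cok p) (cok (hleg Y i))),
    q ;v coker p = vleg X i /\
    r ;v coker (hleg X i) = coker p /\
    sq m (F i) (coker p) (coker (hleg Y i)) /\
  exists (a : ver (kern q) (homology i X)) (b : hor (kern q) (homology i Y)),
    sq (ker q) (ker (vbar X i)) a r /\
    b ;h ker (vbar Y i) = ker q ;h m /\
    span_eq t (MkSpan a b).

(** Dually, for a vertical Z --> Y: [m] is Z_i\Q --> Y_i\Ybar_i; [a] and [b]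
    are the induced maps on cokernels, read in H_i(Y) and H_i(Z) through the
    canonical isomorphisms [ey'] and [ez]. *)
Definition induced_ver Z Y (G : VerMap Z Y) (i : I)
    (t : Span (homology i Y) (homology i Z)) : Prop :=
  exists (Q : A) (q : ver Q (Z i)) (q' : ver Q (bar Y i)),
    v_pullback q q' (G i) (vleg Y i) /\
  exists (p : hor (bar Z (s i)) (kern q)) (r : hor (kern q) (kern (vleg Z i)))
      (m : ver (kern q) (kern (vleg Y i))),
    p ;h ker q = hleg Z i /\
    r ;h ker (vleg Z i) = ker q /\
    sq (ker q) (ker (vleg Y i)) m (G i) /\
  exists (ey : hor (homology i Y) (homology' i Y))
      (ey' : ver (homology i Y) (homology' i Y))
      (ez : hor (homology i Z) (homology' i Z))
      (ez' : ver (homology i Z) (homology' i Z)),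
    homology_comparison ey ey' /\
    homology_comparison ez ez' /\
  exists (a : ver (cok p) (homology i Y)) (b : hor (cok p) (homology i Z)),
    (a ;v ey') ;v coker (hbar Y i) = coker p ;v m /\
    sq (b ;h ez) r (coker p) (coker (hbar Z i)) /\
    span_eq t (MkSpan a b).

(** A chain map is factored as X <-- Z >--> Y with Z a complex. *)
Definition induced X Y (f : ChainMap X Y) (i : I)
    (t : Span (homology i X) (homology i Y)) : Prop :=
  exists (Z : Complex A s) (G : VerMap Z X) (F : HorMap Z Y),
    (forall j, span_eq (f j) (MkSpan (G j) (F j))) /\
  exists (t1 : Span (homology i X) (homology i Z))
      (t2 : Span (homology i Z) (homology i Y)),
    induced_ver G t1 /\ induced_hor F t2 /\ span_eq t (span_comp t1 t2).

End Complexes.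

Arguments induced_hor {A I s X Y} F i t.
Arguments induced_ver {A I s Z Y} G i t.
Arguments induced {A I s X Y} f i t.

Definition Ch (A : ACGW) : Category := {|
  cat_ob := Complex A Z.succ;
  cat_hom := @ChainMap A Z Z.succ;
  cat_eq := @chain_eq A Z Z.succ;
  cat_id := @chain_id A Z Z.succ;
  cat_comp := @chain_comp A Z Z.succ;
  cat_eq_refl := fun _ _ f i => span_eq_refl (f i);
  cat_eq_sym := fun _ _ f g H i => span_eq_sym (H i);
  cat_eq_trans := fun _ _ f g h H K i => span_eq_trans (H i) (K i);
  cat_comp_eq := fun _ _ _ f f' g g' H K i => span_comp_eq (H i) (K i);
  cat_comp_id_l := fun _ _ f i => span_comp_id_l (f i);
  cat_comp_id_r := fun _ _ f i => span_comp_id_r (f i);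
  cat_comp_assoc := fun _ _ _ _ f g h i => span_comp_assoc (f i) (g i) (h i)
|}.

(** * The long exact sequence of X >--> Y <-- Q

    Its terms, with [les_succ n] the term mapping to the term [n]:
    .. H_{i+1}(Q) -> H_i(X) -> H_i(Y) -> H_i(Q) -> H_{i-1}(X) .. *)

Inductive les_kind : Set := Sub | Total | Quot.

Definition les_succ (n : Z * les_kind) : Z * les_kind :=
  match n with
  | (i, Sub) => (Z.succ i, Quot)
  | (i, Total) => (i, Sub)
  | (i, Quot) => (i, Total)
  end.

Definition les_ob (A : ACGW) (X Y Q : Complex A Z.succ) (n : Z * les_kind) : A :=
  match n with
  | (i, Sub) => homology i X
  | (i, Total) => homology i Y
  | (i, Quot) => homology i Q
  end.

(* Main.v *)
Require Import Defs.
From Stdlib Require Import ZArith IndefiniteDescription Setoid Morphisms Eqdep_dec.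

(** Horizontal subobjects, vertical subobjects and ⊘ behave like subobjects,
    quotients and images in a Puppe-exact category: a mixed square restricts to
    a pullback of the kernels of its vertical sides and of the cokernels of its
    horizontal sides, and is determined by either.  This gives the third
    isomorphism theorem and the 3x3 lemma.  The snake lemma is two 3x3 lemmas
    glued along the object of elements of Y that die in Z modulo X, which
    appears both as a quotient of C\Z and as a subobject of A'/X.

    For functoriality, A^flat makes horizontal morphisms monic, vertical
    morphisms epic, and squares commutative, so that H_i(f) is the unique
    morphism compatible with the restriction of f to cycles.

    For the long exact sequence, let Zn, Bn be the cycles and boundaries of
    Y_i.  The images of H_i(X) -> H_i(Y) -> H_i(Y/X) are (X /\ Zn)/(X /\ Bn)
    and Zn/(Zn /\ (X \/ Bn)), and the differential identifies the cokernel
    of the second one at i + 1 with the kernel (X /\ Bn)/Xbar_{i+1} of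
    H_i(X) -> H_i(Y). *)

Set Implicit Arguments.
Unset Strict Implicit.

(** * Horizontal subobjects, pullbacks, and cancellation in mixed squares *)

Section Basics.
Context {A : ACGW}.

Lemma hiso_over_refl (B C : A) (f : hor B C) : hiso_over f f.
Proof.
exists (hid B); split; [|apply hcomp_id_l].
exists (hid B); split; apply hcomp_id_l.
Qed.

Lemma hiso_over_sym (B B' C : A) (f : hor B C) (f' : hor B' C) :
  hiso_over f f' -> hiso_over f' f.
Proof.
intros [e [[g [eg ge]] H]]; exists g; split; [now exists e|].
now rewrite <- H, <- hcomp_assoc, ge, hcomp_id_l.
Qed.

Lemma is_hiso_comp (B C E : A) (f : hor B C) (g : hor C E) :
  is_hiso f -> is_hiso g -> is_hiso (f ;h g).
Proof.
intros [f' [Hf Hf']] [g' [Hg Hg']]; exists (g' ;h f'); split.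
- now rewrite hcomp_assoc, <- (hcomp_assoc g), Hg, hcomp_id_l.
- now rewrite hcomp_assoc, <- (hcomp_assoc f'), Hf', hcomp_id_l.
Qed.

Lemma hiso_over_trans (B B' B'' C : A)
    (f : hor B C) (f' : hor B' C) (f'' : hor B'' C) :
  hiso_over f f' -> hiso_over f' f'' -> hiso_over f f''.
Proof.
intros [e [He H]] [e' [He' H']]; exists (e ;h e').
split; [now apply is_hiso_comp|now rewrite hcomp_assoc, H'].
Qed.

Lemma hiso_over_antisym (B B' C : A) (f : hor B C) (f' : hor B' C)
    (t : hor B B') (t' : hor B' B) :
  t ;h f' = f -> t' ;h f = f' -> hiso_over f f'.
Proof.
intros H H'; exists t; split; trivial; exists t'; split.
- apply (hmonic (g := f)); now rewrite hcomp_assoc, H', H, hcomp_id_l.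
- apply (hmonic (g := f')); now rewrite hcomp_assoc, H, H', hcomp_id_l.
Qed.

Lemma h_pullback_unique (P P' B C E : A) (p : hor P B) (q : hor P C)
    (p' : hor P' B) (q' : hor P' C) (f : hor B E) (g : hor C E) :
  h_pullback p q f g -> h_pullback p' q' f g -> hiso_over p p'.
Proof.
intros [H U] [H' U'].
destruct (U' _ _ _ H) as [t [[Ht _] _]].
destruct (U _ _ _ H') as [t' [[Ht' _] _]].
now apply hiso_over_antisym with t t'.
Qed.

Lemma h_pullback_sym (P B C E : A) (p : hor P B) (q : hor P C)
    (f : hor B E) (g : hor C E) : h_pullback p q f g -> h_pullback q p g f.
Proof.
intros [H U]; split; [now symmetry|].
intros T a b Hab; destruct (U T b a (eq_sym Hab)) as [t [[H1 H2] H3]].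
exists t; split; [now split|]; intros t' [H1' H2']; now apply H3.
Qed.

Lemma h_pullback_iso (P P' B C C' E : A) (p : hor P B) (q : hor P C)
    (f : hor B E) (g : hor C E) (p' : hor P' B) (g' : hor C' E) :
  h_pullback p q f g -> hiso_over p' p -> hiso_over g g' ->
  exists q', h_pullback p' q' f g'.
Proof.
intros [H U] Hp [d [[d' [dd dd']] Hd]].
destruct (hiso_over_sym Hp) as [i [_ Hi]].
destruct Hp as [e [_ He]].
exists (e ;h q ;h d); split.
- now rewrite hcomp_assoc, Hd, hcomp_assoc, <- H, <- hcomp_assoc, He.
- intros T a b Hab; destruct (U T a (b ;h d')) as [t [[H1 H2] _]].
  { now rewrite Hab, hcomp_assoc, <- Hd, <- (hcomp_assoc d'), dd', hcomp_id_l. }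
  assert (E1 : t ;h i ;h p' = a) by now rewrite hcomp_assoc, Hi.
  exists (t ;h i); split; [split; trivial|].
  + apply (hmonic (g := g')).
    now rewrite <- Hab, <- E1, !hcomp_assoc, Hd, <- H, <- (hcomp_assoc e), He.
  + intros t' [E1' _]; apply (hmonic (g := p')); now rewrite E1, E1'.
Qed.

Lemma h_pullback_factor (B C E : A) (j : hor B C) (k : hor C E) :
  h_pullback j (hid B) k (j ;h k).
Proof.
split; [now rewrite hcomp_id_l|].
intros T a b H; exists b; split.
- split; [|apply hcomp_id_r].
  apply (hmonic (g := k)); now rewrite hcomp_assoc.
- intros t [_ Ht]; now rewrite <- Ht, hcomp_id_r.
Qed.

Lemma same_fun (B C : A) (f : hor B C) (u u' : ver B C) :
  same f u -> same f u' -> u = u'.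
Proof.
intros H H'; destruct (same_of_h (same_hiso H)) as [x [_ Hx]].
now rewrite <- (Hx u H), (Hx u' H').
Qed.

Lemma sq_ext_top (B' B C E F : A) (f : hor B C) (g : hor E F)
    (u : ver B E) (v : ver C F) (f' : hor B' C) (u' : ver B' E)
    (e : hor B' B) (e' : ver B' B) :
  sq f g u v -> same e e' -> e ;h f = f' -> e' ;v u = u' -> sq f' g u' v.
Proof.
intros S H <- <-.
assert (T : sq (e ;h f) f e' (vid C)).
{ apply (proj2 (sq_viso _ _ H (same_id C))); apply hcomp_id_r. }
pose proof (sq_vcomp T S) as R; now rewrite vcomp_id_l in R.
Qed.

(** Pasting the corner of [g] and [v] with the right-hand square gives a second square with the
    bottom and right side of the outer one. Uniqueness of corners identifies the two, and monicity
    of [f'] identifies the tops. *)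
Lemma sq_hcancel (B B' B'' C C' C'' : A) (f : hor B B') (f' : hor B' B'')
    (g : hor C C') (g' : hor C' C'') (u : ver B C) (v : ver B' C')
    (w : ver B'' C'') :
  sq (f ;h f') (g ;h g') u w -> sq f' g' v w -> sq f g u v.
Proof.
intros S T.
destruct (mix_unique2 S (sq_hcomp (mix_sq g v) T)) as [e [e' [H [E1 E2]]]].
apply (sq_ext_top (mix_sq g v) H); trivial.
apply (hmonic (g := f')); now rewrite hcomp_assoc.
Qed.

Lemma sq_left_unique (B C E F : A) (f : hor B C) (g : hor E F)
    (u u' : ver B E) (v : ver C F) : sq f g u v -> sq f g u' v -> u = u'.
Proof.
intros S T; destruct (mix_unique2 S T) as [e [e' [H [E1 E2]]]].
assert (e = hid B) as ->
  by (apply (hmonic (g := f)); now rewrite hcomp_id_l).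
rewrite (same_fun H (same_id B)), vcomp_id_l in E2; now symmetry.
Qed.

(** The transpose of [sq_coker], obtained by transporting it along the isomorphism of
    [coker (ker u)] with [u]; it is a field of the opposite structure. *)
Lemma sq_hinit_ker (B C : A) (u : ver B C) :
  sq (hinit B) (ker u) (vinit (kern u)) u.
Proof.
destruct (coker_ker u) as [e [He Hu]].
destruct (same_of_v He) as [f [Hf _]].
destruct (same_inv Hf) as [g [w [Hg [_ [_ [_ wf]]]]]].
assert (S : sq (hinit B) (hinit (cok (ker u))) (vid (empty A)) w).
{ apply (proj2 (sq_viso _ _ (same_id _) Hg)).
  now rewrite (hinit_unique (hinit B ;h g)), hcomp_id_l. }
pose proof (sq_vcomp S (sq_coker (ker u))) as T.
now rewrite <- Hu, <- vcomp_assoc, wf, !vcomp_id_l in T.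
Qed.

End Basics.

(** * Duality exchanging horizontal and vertical morphisms *)

Section Opposite.
Context (A : ACGW).

Lemma mix_unique_op (B C E F : A) (f : hor B E) (v : ver C E)
    (t : hor F C) (l : ver F B) : sq t f l v ->
  exists! e : ver F (mix f v), exists e' : hor F (mix f v),
    same e' e /\ e ;v mix_left f v = l /\ e' ;h mix_top f v = t.
Proof.
intros S; destruct (mix_unique S) as [e [[e' [H [Ht Hl]]] _]].
exists e'; split; [now exists e|].
intros x [x' [_ [Hx _]]]; apply (vmonic (w := mix_left f v)); congruence.
Qed.

(** Transposition: arrows keep their direction and change their type. Kernels and cokernels are
    thereby exchanged, so a statement about one yields the statement about the other at [op A]. *)
Definition op_dc : DoubleCategory := {|
  ob := A;
  hor := @ver A;
  ver := @hor A;
  hid := @vid A;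
  vid := @hid A;
  hcomp := @vcomp A;
  vcomp := @hcomp A;
  hcomp_id_l := @vcomp_id_l A;
  hcomp_id_r := @vcomp_id_r A;
  hcomp_assoc := @vcomp_assoc A;
  vcomp_id_l := @hcomp_id_l A;
  vcomp_id_r := @hcomp_id_r A;
  vcomp_assoc := @hcomp_assoc A;
  sq := fun B C E F f g u v => @sq A B E C F u v f g;
  sq_hid := @sq_vid A;
  sq_vid := @sq_hid A;
  sq_hcomp := fun B C C' E F F' f f' g g' u v w =>
    @sq_vcomp A B E C F C' F' u v w f g f' g';
  sq_vcomp := fun B C E F G H f g h u v u' v' =>
    @sq_hcomp A B E G C F H u u' v v' f g h
|}.

Definition op : ACGW := {|
  dc := op_dc;
  empty := empty A;
  hinit := @vinit A;
  vinit := @hinit A;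
  hinit_unique := @vinit_unique A;
  vinit_unique := @hinit_unique A;
  hmonic := @vmonic A;
  vmonic := @hmonic A;
  same := fun B C f u => @same A B C u f;
  same_hiso := fun B C f u => @same_viso A B C u f;
  same_viso := fun B C f u => @same_hiso A B C u f;
  same_of_h := @same_of_v A;
  same_of_v := @same_of_h A;
  same_id := @same_id A;
  same_comp := fun B C E f u g w H K => @same_comp A B C E u f w g H K;
  sq_hiso := fun B C E F f g u v f' g' H K =>
    iff_trans (@sq_viso A B E C F u v f g f' g' H K)
      (conj (@eq_sym _ _ _) (@eq_sym _ _ _));
  sq_viso := fun B C E F f g u v u' v' H K =>
    iff_trans (@sq_hiso A B E C F u v f g u' v' H K)
      (conj (@eq_sym _ _ _) (@eq_sym _ _ _));
  cok := @kern A;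
  coker := @ker A;
  kern := @cok A;
  ker := @coker A;
  coker_iso := @ker_iso A;
  ker_iso := @coker_iso A;
  ker_coker := @coker_ker A;
  coker_ker := @ker_coker A;
  sq_coker := @sq_hinit_ker A;
  coker_sq := fun B C E F f g u v => @ker_sq A B E C F u v f g;
  coker_ff := fun B C E F f g v w => @ker_ff A B E C F v f g w;
  ker_sq := fun B C E F f g u v => @coker_sq A B E C F u v f g;
  ker_ff := fun B C E F g u v m => @coker_ff A B E C F u v g m;
  mix := fun B C E f v => @mix A C B E v f;
  mix_top := fun B C E f v => @mix_left A C B E v f;
  mix_left := fun B C E f v => @mix_top A C B E v f;
  mix_sq := fun B C E f v => @mix_sq A C B E v f;
  mix_unique := fun B C E f v F t l => @mix_unique_op C B E F v f l t
|}.

End Opposite.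

(** * Kernel-cokernel pairs and the mixed squares they determine *)

Section Pairs.
Context {A : ACGW}.

Lemma kcp_coker (B C : A) (f : hor B C) : ker_coker_pair f (coker f).
Proof. apply hiso_over_sym, ker_coker. Qed.

Lemma kcp_ker (B C : A) (u : ver B C) : ker_coker_pair (ker u) u.
Proof. apply hiso_over_refl. Qed.

(** [ker_coker_pair] is stated through kernels only; this is the equivalent form through cokernels,
    which makes the notion self-dual. *)
Lemma kcp_op (B C E : A) (f : hor B C) (u : ver E C) :
  ker_coker_pair f u <-> @ker_coker_pair (op A) E C B u f.
Proof.
split; intros H.
- apply (@hiso_over_trans (op A) _ _ _ _ u (coker (ker u)) (@ker (op A) _ _ f)).
  + apply (@hiso_over_sym (op A)), (coker_ker u).
  + apply (@hiso_over_sym (op A)), (coker_iso H).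
- apply hiso_over_trans with (f' := ker (coker f)).
  + apply hiso_over_sym, ker_coker.
  + apply hiso_over_sym, (ker_iso H).
Qed.

Lemma viso_over_of_kcp (B C E E' : A) (f : hor B C) (u : ver E C) (u' : ver E' C) :
  ker_coker_pair f u -> ker_coker_pair f u' -> viso_over u u'.
Proof.
intros H H'.
apply (@hiso_over_trans (op A) _ _ _ _ u (coker f) u'); [now apply kcp_op|].
now apply (@hiso_over_sym (op A)), kcp_op.
Qed.

Lemma hiso_over_of_kcp (B B' C E : A) (f : hor B C) (f' : hor B' C) (u : ver E C) :
  ker_coker_pair f u -> ker_coker_pair f' u -> hiso_over f f'.
Proof.
intros H H'; exact (hiso_over_trans H (hiso_over_sym H')).
Qed.

Lemma kcp_hiso (B B' C E : A) (f : hor B C) (f' : hor B' C) (u : ver E C) :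
  hiso_over f' f -> ker_coker_pair f u -> ker_coker_pair f' u.
Proof. intros H K; exact (hiso_over_trans H K). Qed.

Lemma kcp_viso (B C E E' : A) (f : hor B C) (u : ver E C) (u' : ver E' C) :
  viso_over u' u -> ker_coker_pair f u -> ker_coker_pair f u'.
Proof.
intros H K; apply kcp_op; apply kcp_op in K.
exact (@hiso_over_trans (op A) _ _ _ _ _ _ _ H K).
Qed.

(** This lemma and the next free [ker_sq] and [ker_ff] from the chosen kernels. *)
Lemma hpb_of_sq (B C E F K L : A) (f : hor B C) (g : hor E F)
    (u : ver B E) (v : ver C F) (k : hor K E) (l : hor L F) :
  sq f g u v -> ker_coker_pair k u -> ker_coker_pair l v ->
  exists m, h_pullback k m g l.
Proof.
intros S Hk Hl; destruct (ker_sq S) as [m Hm].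
exact (h_pullback_iso Hm Hk (hiso_over_sym Hl)).
Qed.

Lemma sq_of_hpb (B C E F K L : A) (g : hor E F) (u : ver B E) (v : ver C F)
    (k : hor K E) (l : hor L F) (m : hor K L) :
  h_pullback k m g l -> ker_coker_pair k u -> ker_coker_pair l v ->
  exists f, sq f g u v.
Proof.
intros P Hk Hl.
destruct (h_pullback_iso P (hiso_over_sym Hk) Hl) as [m' P'].
destruct (ker_ff P') as [f [S _]]; now exists f.
Qed.

End Pairs.

(** * The third isomorphism theorem and the 3x3 lemma *)

Section PairsOp.
Context {A : ACGW}.

Lemma vpb_of_sq (B C E F K L : A) (f : hor B C) (g : hor E F)
    (u : ver B E) (v : ver C F) (c : ver K C) (d : ver L F) :
  sq f g u v -> ker_coker_pair f c -> ker_coker_pair g d ->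
  exists w, v_pullback c w v d.
Proof.
intros S Hc Hd; apply kcp_op in Hc; apply kcp_op in Hd.
exact (@hpb_of_sq (op A) _ _ _ _ _ _ u v f g c d S Hc Hd).
Qed.

Lemma sq_of_vpb (B C E F K L : A) (f : hor B C) (g : hor E F) (v : ver C F)
    (c : ver K C) (d : ver L F) (w : ver K L) :
  v_pullback c w v d -> ker_coker_pair f c -> ker_coker_pair g d ->
  exists u, sq f g u v.
Proof.
intros P Hc Hd; apply kcp_op in Hc; apply kcp_op in Hd.
exact (@sq_of_hpb (op A) _ _ _ _ _ _ v f g c d w P Hc Hd).
Qed.

(** Both [j] and the kernel of the new side are pullbacks of [k] and [h]. *)
Lemma third_iso (N K Y V C T : A) (j : hor N K) (k : hor K Y) (h : hor N Y)
    (v : ver V Y) (c : ver C Y) (w : ver V C) (x : hor T C) :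
  ker_coker_pair k v -> ker_coker_pair h c -> ker_coker_pair x w ->
  j ;h k = h -> w ;v c = v ->
  exists l, sq x k l c /\ ker_coker_pair j l.
Proof.
intros Hk Hh Hx <- <-.
destruct (sq_of_vpb (@h_pullback_factor (op A) _ _ _ w c) Hx Hk) as [l S].
exists l; split; trivial.
destruct (hpb_of_sq S (kcp_ker l) Hh) as [m P].
exact (h_pullback_unique (h_pullback_factor j k) P).
Qed.

(** The two sides are those of the corner of [k] and [d]. *)
Lemma nine (V C Y N K E F : A) (g : hor C Y) (v : ver V Y)
    (n : hor N C) (k : hor K Y) (m : hor N K)
    (c : ver E V) (d : ver F Y) (w : ver E F) :
  h_pullback n m g k -> v_pullback c w v d ->
  ker_coker_pair k v -> ker_coker_pair g d ->
  exists (T : A) (x : hor T F) (y : ver T K),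
    sq x k y d /\ ker_coker_pair m y /\ ker_coker_pair x w.
Proof.
intros Pn Pc Hk Hg.
exists (mix k d), (mix_top k d), (mix_left k d).
pose proof (mix_sq k d) as S; split; trivial; split.
- destruct (hpb_of_sq S (kcp_ker _) Hg) as [m' P].
  exact (h_pullback_unique (h_pullback_sym Pn) P).
- destruct (vpb_of_sq S (kcp_coker _) Hk) as [m' P].
  apply kcp_op.
  exact (@h_pullback_unique (op A) _ _ _ _ _ _ _ _ _ _ _
    (@h_pullback_sym (op A) _ _ _ _ _ _ _ _ Pc) P).
Qed.

End PairsOp.

(** * Order reversal between subobjects and quotients; emptiness *)

Section Order.

Lemma kcp_hinit {A : ACGW} (B C : A) (u : ver B C) :
  is_viso u -> ker_coker_pair (hinit C) u.
Proof.
intros Hu; apply (kcp_viso (u := coker (hinit C))); [|apply kcp_coker].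
destruct (coker_hinit C) as [c [Hc Hc']].
exists (u ;v c); split.
- apply (@is_hiso_comp (op A)); [exact Hu|now exists (coker (hinit C))].
- now rewrite vcomp_assoc, Hc', vcomp_id_r.
Qed.

Lemma kcp_vinit {A : ACGW} (B C : A) (f : hor B C) :
  is_hiso f -> ker_coker_pair f (vinit C).
Proof. intros Hf; apply kcp_op; exact (@kcp_hinit (op A) _ _ f Hf). Qed.

Lemma hid_hiso {A : ACGW} (B : A) : is_hiso (hid B).
Proof. exists (hid B); split; apply hcomp_id_l. Qed.

Lemma h_pullback_hid {A : ACGW} (B C : A) (f : hor B C) :
  h_pullback (hid B) f f (hid C).
Proof.
split; [now rewrite hcomp_id_l, hcomp_id_r|].
intros T a b H; exists a; split.
- split; [apply hcomp_id_r|now rewrite H, hcomp_id_r].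
- intros t [Ht _]; now rewrite <- Ht, hcomp_id_r.
Qed.

Context {A : ACGW}.

(** The kernel of [c] meets [c] in the empty object, hence also meets [v], which factors through
    [c]. Restricting that square to kernels of its vertical sides yields the factorization through
    [k]. *)
Lemma ker_le (N K Y V C : A) (k : hor K Y) (h : hor N Y) (v : ver V Y)
    (c : ver C Y) (w : ver V C) :
  ker_coker_pair k v -> ker_coker_pair h c -> w ;v c = v ->
  exists j : hor N K, j ;h k = h.
Proof.
intros Hk [i [_ Hi]] Hw.
destruct (sq_of_vpb (@h_pullback_hid (op A) _ _ w)
  (kcp_hinit (@hid_hiso (op A) V)) (kcp_hinit (@hid_hiso (op A) C))) as [u S].
pose proof (sq_vcomp S (sq_hinit_ker c)) as T; rewrite Hw in T.
rewrite (vinit_unique (u ;v _)) in T.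
destruct (hpb_of_sq T (kcp_vinit (hid_hiso _)) Hk) as [m [Hm _]].
exists (i ;h m); now rewrite hcomp_assoc, <- Hm, hcomp_id_l.
Qed.

End Order.

Section OrderOp.
Context {A : ACGW}.

Lemma coker_le (N K Y V C : A) (k : hor K Y) (h : hor N Y) (v : ver V Y)
    (c : ver C Y) (j : hor N K) :
  ker_coker_pair k v -> ker_coker_pair h c -> j ;h k = h ->
  exists w : ver V C, w ;v c = v.
Proof.
intros Hk Hh Hj; apply kcp_op in Hk; apply kcp_op in Hh.
exact (@ker_le (op A) _ _ _ _ _ c v h k j Hh Hk Hj).
Qed.

Lemma is_empty_of_hiso (E : A) (f : hor (empty A) E) : is_hiso f -> is_empty E.
Proof. now rewrite (hinit_unique f). Qed.

(** [sq_hinit_ker] is a square on [ker u] and [u] whose corner is empty, and corners are unique. *)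
Lemma kcp_zero_at (B C E : A) (f : hor B C) (u : ver E C) :
  ker_coker_pair f u -> zero_at f u.
Proof.
intros [e [He Hf]]; destruct (same_of_h He) as [e' [H _]].
assert (T : sq f (ker u) e' (vid C)).
{ apply (proj2 (sq_viso _ _ H (same_id C))); now rewrite Hf, hcomp_id_r. }
pose proof (sq_vcomp (mix_sq f u) T) as S; rewrite vcomp_id_r in S.
destruct (mix_unique2 (sq_hinit_ker u) S) as [d [d' [D _]]].
exact (is_empty_of_hiso (same_hiso D)).
Qed.

(** The kernel here has the form of a homology object, so exactness of a complex reduces to pairs.
    By monicity [to_coker z] is the isomorphism of [v] with [coker h]. *)
Lemma kcp_to_coker (U X V : A) (h : hor U X) (v : ver V X) (z : zero_at h v) :
  ker_coker_pair h v -> is_empty (kern (to_coker z)).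
Proof.
intros H; apply kcp_op in H; destruct H as [e [He Hv]].
assert (to_coker z = e) as ->
  by (apply (vmonic (w := coker h)); rewrite to_cokerE; symmetry; exact Hv).
destruct (hiso_over_of_kcp (kcp_hinit He) (kcp_ker e)) as [d [Hd _]].
exact (is_empty_of_hiso Hd).
Qed.

End OrderOp.

(** * The snake lemma *)

Section Snake.
Context (A : ACGW).

Lemma snake (A0 Ab B C X Y Z A' B' Cb' C' : A)
     (Ab_A : ver Ab A0) (Ab_B : hor Ab B) (C_B : ver C B)
     (X_Y : hor X Y) (Z_Y : ver Z Y)
     (A'_B' : hor A' B') (Cb'_B' : ver Cb' B') (Cb'_C' : hor Cb' C')
     (X_A : ver X A0) (X_Ab : ver X Ab) (Y_B : ver Y B) (Z_C : ver Z C)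
     (X_A' : hor X A') (Y_B' : hor Y B') (Z_Cb' : hor Z Cb') (Z_C' : hor Z C') :
     ker_coker_pair Ab_B C_B ->
     ker_coker_pair A'_B' Cb'_B' ->
     X_Ab ;v Ab_A = X_A ->
     sq X_Y Ab_B X_Ab Y_B ->
     Z_Y ;v Y_B = Z_C ;v C_B ->
     X_Y ;h Y_B' = X_A' ;h A'_B' ->
     sq Z_Cb' Y_B' Z_Y Cb'_B' ->
     Z_Cb' ;h Cb'_C' = Z_C' ->
     exists (D W D' : A)
       (_ : ver (kern X_Ab) (kern X_A))
       (f1 : hor (kern X_Ab) (kern Y_B)) (g1 : ver D (kern Y_B))
       (f2 : hor D (kern Z_C)) (g2 : ver W (kern Z_C))
       (f3 : hor W (cok X_A')) (g3 : ver D' (cok X_A'))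
       (f4 : hor D' (cok Y_B')) (g4 : ver (cok Z_Cb') (cok Y_B'))
       (_ : hor (cok Z_Cb') (cok Z_C')),
       ker_coker_pair f1 g1 /\ ker_coker_pair f2 g2 /\
       ker_coker_pair f3 g3 /\ ker_coker_pair f4 g4.
Proof.
intros HB HB' <- S1 EZ EX S2 <-.
destruct (sq_of_vpb (@h_pullback_factor (op A) _ _ _ X_Ab Ab_A)
  (kcp_ker X_Ab) (kcp_ker (X_Ab ;v Ab_A))) as [f0 _].
destruct (sq_of_hpb (h_pullback_factor Z_Cb' Cb'_C')
  (kcp_coker Z_Cb') (kcp_coker (Z_Cb' ;h Cb'_C'))) as [f5 _].
(* First 3x3 lemma: [D] is at once the cokernel of [kern X_Ab] in [kern Y_B] and the kernel of [w1],
   the map from [cok X_Y] to [C]. *)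
destruct (hpb_of_sq S1 (kcp_ker X_Ab) (kcp_ker Y_B)) as [m1 P1].
destruct (vpb_of_sq S1 (kcp_coker X_Y) HB) as [w1 Q1].
destruct (nine P1 Q1 (kcp_ker Y_B) HB) as [D [x1 [y1 [_ [H1 K1]]]]].
(* Since [cok X_Y] is a pullback over [B], [Z] maps to it by [w2]. The middle object [W] is the
   kernel of [w2]. *)
destruct (proj2 Q1 _ _ _ EZ) as [w2 [[E1 E2] _]].
destruct (ker_le (kcp_ker Z_C) K1 E2) as [f2 F2].
destruct (third_iso (kcp_ker Z_C) K1 (kcp_ker w2) F2 E2) as [g2 [_ H2]].
(* Inside [Y] instead of [C], the same [kern w2] becomes the cokernel of [j], that is, [kern Z_Y]
   modulo [X]. *)
destruct (ker_le (kcp_ker Z_Y) (kcp_coker X_Y) E1) as [j J].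
destruct (third_iso (kcp_ker Z_Y) (kcp_coker X_Y) (kcp_ker w2) J E1)
  as [l [_ L]].
(* Second 3x3 lemma: [D'] is the cokernel of [kern Z_Y] in [A'] and the kernel of [w3]. *)
destruct (hpb_of_sq S2 (kcp_ker Z_Y) HB') as [m2 P2].
destruct (vpb_of_sq S2 (kcp_coker Z_Cb') (kcp_coker Y_B')) as [w3 Q3].
destruct (nine P2 Q3 HB' (kcp_coker Y_B')) as [D' [f4 [y3 [_ [H3 H4]]]]].
assert (JA : j ;h m2 = X_A').
{ apply (hmonic (g := A'_B')).
  now rewrite hcomp_assoc, <- (proj1 P2), <- hcomp_assoc, J. }
destruct (coker_le H3 (kcp_coker X_A') JA) as [g3 G3].
destruct (third_iso H3 (kcp_coker X_A') (kcp_ker g3) JA G3) as [l' [_ L']].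
(* [kern w2] and [kern g3] are both cokernels of [j]; this isomorphism glues the two halves. *)
destruct (viso_over_of_kcp L L') as [e [He _]].
destruct (same_of_v He) as [e' [He' _]].
exists D, (kern w2), D', f0, m1, y1, f2, g2, (e' ;h ker g3), g3, f4, w3, f5.
repeat split; trivial.
exists e'; split; [exact (same_hiso He')|reflexivity].
Qed.
End Snake.

(** * Isomorphic objects and existence of pullbacks *)

Section Isomorphic.
Context {A : ACGW}.

Definition isomorphic (B C : A) : Prop := exists f : hor B C, is_hiso f.

Lemma isomorphic_sym (B C : A) : isomorphic B C -> isomorphic C B.
Proof. intros [f [g [H K]]]; exists g; now exists f. Qed.

Lemma isomorphic_trans (B C E : A) :
  isomorphic B C -> isomorphic C E -> isomorphic B E.
Proof. intros [f H] [g K]; exists (f ;h g); now apply is_hiso_comp. Qed.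

Lemma viso_over_isomorphic (B B' C : A) (u : ver B C) (u' : ver B' C) :
  viso_over u u' -> isomorphic B B'.
Proof.
intros [e [He _]]; destruct (same_of_v He) as [f [H _]].
exists f; exact (same_hiso H).
Qed.

Lemma kcp_isomorphic_ver (B C E E' : A) (f : hor B C) (u : ver E C) (u' : ver E' C) :
  ker_coker_pair f u -> ker_coker_pair f u' -> isomorphic E E'.
Proof. intros H K; exact (viso_over_isomorphic (viso_over_of_kcp H K)). Qed.

Lemma kcp_isomorphic_hor (B B' C E : A) (f : hor B C) (f' : hor B' C) (u : ver E C) :
  ker_coker_pair f u -> ker_coker_pair f' u -> isomorphic B B'.
Proof.
intros H K; destruct (hiso_over_of_kcp H K) as [e [He _]]; now exists e.
Qed.

(** The pullback is the kernel of the left side of the corner of [f] and [coker g]. *)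
Lemma h_pullback_ex (B C E : A) (f : hor B E) (g : hor C E) :
  exists (P : A) (p : hor P B) (q : hor P C), h_pullback p q f g.
Proof.
destruct (hpb_of_sq (mix_sq f (coker g)) (kcp_ker _) (kcp_coker g)) as [m P].
eauto.
Qed.

End Isomorphic.

(** * Induced maps on homology, their exactness and the connecting isomorphism *)

Section HomologyMaps.
Context {A : ACGW} {I : Type} {s : I -> I}.
Implicit Types X Y Z : Complex A s.

Lemma vbarE X i : vbar X i ;v coker (hleg X i) = vleg X i.
Proof. apply to_cokerE. Qed.

Lemma hbarE X i : hbar X i ;h ker (vleg X i) = hleg X i.
Proof. apply to_kerE. Qed.

(** The third isomorphism theorem for [vleg X i], factored through the cokernel of [hleg X i]. *)
Lemma homology_comparison_ex X i :
  exists (e : hor (homology i X) (homology' i X)) e', homology_comparison e e'.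
Proof.
destruct (third_iso (kcp_ker (vleg X i)) (kcp_coker (hleg X i))
  (kcp_ker (vbar X i)) (hbarE X i) (vbarE X i)) as [l [S H]].
apply kcp_op in H; destruct H as [e' [He H]].
destruct (same_of_v He) as [e [E _]]; exists e, e'; split; trivial.
now rewrite <- H in S.
Qed.

Lemma hmap_bar X Y (F : HorMap X Y) : exists hb : forall i, hor (bar X i) (bar Y i),
  (forall i, sq (hb i) (F i) (vleg X i) (vleg Y i)) /\
  (forall i, hb (s i) ;h hleg Y i = hleg X i ;h F i).
Proof.
destruct (hmap_chain F) as [hb H]; exists hb; split; intros i; apply (H i).
Qed.

Lemma vmap_bar Z Y (G : VerMap Z Y) : exists vb : forall i, ver (bar Z i) (bar Y i),
  (forall i, vb i ;v vleg Y i = vleg Z i ;v G i) /\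
  (forall i, sq (hleg Z i) (hleg Y i) (vb (s i)) (G i)).
Proof.
destruct (vmap_chain G) as [vb H]; exists vb; split; intros i; apply (H i).
Qed.

Lemma induced_hor_ex X Y (F : HorMap X Y) i : exists t, induced_hor F i t.
Proof.
destruct (hmap_bar F) as [hb [S T]]; specialize (S i); specialize (T i).
destruct (h_pullback_ex (F i) (hleg Y i)) as [P [p [p' PB]]].
destruct (proj2 PB _ _ _ (eq_sym T)) as [e [[Ep _] _]].
destruct (coker_le (kcp_coker p) (kcp_coker (hleg X i)) Ep) as [r Er].
destruct (sq_of_hpb PB (kcp_coker p) (kcp_coker (hleg Y i))) as [m Sm].
(* The corner of [m] and [vbar Y i] pasted onto [Sm] has the same bottom and right side as [S].
   Comparing corners lifts [vleg X i] to [cok p]. *)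
pose proof (sq_vcomp (mix_sq m (vbar Y i)) Sm) as R; rewrite vbarE in R.
destruct (mix_unique2 S R) as [d [d' [D [D1 D2]]]].
pose proof (sq_ext_top (mix_sq m (vbar Y i)) D D1 eq_refl) as Sq.
set (q := d' ;v mix_left m (vbar Y i)) in Sq.
assert (Eq : q ;v coker p = vleg X i)
  by (unfold q; now rewrite vcomp_assoc, D2).
assert (Eqr : q ;v r = vbar X i).
{ apply (vmonic (w := coker (hleg X i))); now rewrite vcomp_assoc, Er, vbarE. }
destruct (sq_of_vpb (@h_pullback_factor (op A) _ _ _ q r) (kcp_ker q)
  (f := ker q) (g := ker (vbar X i))) as [a Sa].
{ simpl; rewrite Eqr; apply kcp_ker. }
destruct (ker_sq Sq) as [b [Hb _]].
exists (MkSpan a b), P, p, p'; split; trivial.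
exists q, r, m; repeat split; trivial.
exists a, b; repeat split; [trivial|now symmetry|apply span_eq_refl].
Qed.

Lemma induced_ver_ex Z Y (G : VerMap Z Y) i : exists t, induced_ver G i t.
Proof.
destruct (vmap_bar G) as [vb [T S]]; specialize (T i); specialize (S i).
destruct (@h_pullback_ex (op A) _ _ _ (G i) (vleg Y i)) as [Q [q [q' PB]]].
destruct (proj2 PB _ _ _ (eq_sym T)) as [x [[Ex _] _]].
destruct (ker_le (kcp_ker (vleg Z i)) (kcp_ker q) Ex) as [r Er].
destruct (sq_of_vpb PB (kcp_ker q) (kcp_ker (vleg Y i))) as [m Sm].
pose proof (sq_hcomp (mix_sq (hbar Y i) m) Sm) as R; rewrite hbarE in R.
destruct (mix_unique2 S R) as [d [d' [D [D1 D2]]]].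
pose proof (sq_ext_top (mix_sq (hbar Y i) m) D eq_refl D2) as Sp.
set (p := d ;h mix_top (hbar Y i) m) in Sp.
assert (Ep : p ;h ker q = hleg Z i)
  by (unfold p; now rewrite hcomp_assoc, D1).
assert (Epr : p ;h r = hbar Z i).
{ apply (hmonic (g := ker (vleg Z i))); now rewrite hcomp_assoc, Er, hbarE. }
destruct (homology_comparison_ex Y i) as [ey [ey' Cy]].
destruct (homology_comparison_ex Z i) as [ez [ez' Cz]].
(* The induced maps on cokernels land in [homology']; [wy] and [wz] are the inverse comparisons
   bringing them back to [homology]. *)
destruct (same_inv (proj1 Cy)) as [_ [wy [_ [_ [_ [_ Wy]]]]]].
destruct (same_inv (proj1 Cz)) as [wz [_ [_ [_ [Wz _]]]]].
destruct (sq_of_hpb (h_pullback_factor p r) (kcp_coker p)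
  (v := coker (hbar Z i))) as [b Sb].
{ rewrite Epr; apply kcp_coker. }
destruct (coker_sq Sp) as [a [Ha _]].
exists (MkSpan (a ;v wy) (b ;h wz)), Q, q, q'; split; trivial.
exists p, r, m; repeat split; trivial.
exists ey, ey', ez, ez'; split; trivial; split; trivial.
exists (a ;v wy), (b ;h wz); repeat split; [| |apply span_eq_refl].
- unfold homology', homology in *; now rewrite (vcomp_assoc a), Wy, vcomp_id_r, Ha.
- unfold homology', homology in *; now rewrite hcomp_assoc, Wz, hcomp_id_r.
Qed.

Lemma kcp_span_eq (B C C' : A) (s1 t1 : Span B C) (s2 t2 : Span C C') :
  span_eq s1 t1 -> span_eq s2 t2 -> ker_coker_pair (rleg t1) (lleg t2) ->
  ker_coker_pair (rleg s1) (lleg s2).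
Proof.
intros [e [e' [H [_ Hr]]]] [d [d' [K [Kl _]]]] Hk.
apply (kcp_hiso (f := rleg t1)); [exists e; split; [exact (same_hiso H)|trivial]|].
apply (kcp_viso (u := lleg t2)); [exists d'; split; [exact (same_viso K)|trivial]|].
exact Hk.
Qed.

(** On cycles, [F] restricts to [mz], whose cokernel is [m2]. Both [coker b] and [a2] are the
    pullback, over the cycles of [Y i], of [m2] and the vertical morphism from the homology of
    [Y]. *)
Lemma exact_at_total X Y Q (F : HorMap X Y) (G : VerMap Q Y) i t1 t2 :
  short_exact F G -> induced_hor F i t1 -> induced_ver G i t2 ->
  ker_coker_pair (rleg t1) (lleg t2).
Proof.
intros FG [P [p [p' [PB [q [r [m [Eq [Er [Sm [a [b [Sa [Eb Et]]]]]]]]]]]]]]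
  [Qb [q2 [q2' [PB2 [p2 [r2 [m2 [Ep2 [Er2 [Sm2 [ey [ey' [ez [ez'
  [Cy [Cz [a2 [b2 [Ea2 [Sb2 Et2]]]]]]]]]]]]]]]]]]]].
apply (kcp_span_eq Et Et2); simpl; clear t1 t2 Et Et2.
specialize (FG i).
destruct (hmap_bar F) as [hb [S _]]; specialize (S i).
destruct (vmap_bar G) as [vb [_ T]]; specialize (T i).
destruct (hpb_of_sq S (kcp_ker _) (kcp_ker _)) as [mz Pmz].
destruct (ker_le (kcp_ker (vleg X i)) (kcp_coker p) Eq) as [j Ej].
destruct (third_iso (kcp_ker (vleg X i)) (kcp_coker p) (kcp_ker q) Ej Eq)
  as [l [Sl _]].
pose proof (sq_hcomp Sl Sm) as R; rewrite <- Eb, (proj1 Pmz) in R.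
pose proof (sq_hcancel R (proj2 Cy)) as Sb.
destruct (hpb_of_sq Sm2 (kcp_ker m2) FG) as [n Pn].
pose proof (h_pullback_unique (h_pullback_sym Pmz) Pn) as Hmz.
destruct (vpb_of_sq Sb (kcp_coker b) Hmz) as [w [Pw Uw]].
rewrite <- Ep2, <- hbarE in T; pose proof (sq_hcancel T Sm2) as Sp2.
destruct (vpb_of_sq Sp2 (kcp_coker p2) (kcp_coker (hbar Y i))) as [w' [Pw' Uw']].
rewrite vcomp_assoc in Ea2; destruct (Uw _ _ _ Ea2) as [t [[Ht _] _]].
rewrite <- vcomp_assoc in Pw, Ea2.
destruct (Uw' _ _ _ (eq_sym Pw)) as [t' [[_ Ht'] _]].
rewrite Pw' in Ea2; apply vmonic in Ea2; subst w'.
rewrite <- vcomp_assoc in Ht'; apply vmonic in Ht'.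
apply (kcp_viso (u := coker b)); [|apply kcp_coker].
exact (@hiso_over_antisym (op A) _ _ _ _ _ _ _ Ht Ht').
Qed.

(** With [Zn] the cycles in [Y (s i)], both objects are
    d^-1(X_i) / (X_{i+1} \/ Zn), a subquotient of [Y (s i)]. *)
Lemma connecting X Y Q (F : HorMap X Y) (G : VerMap Q Y) i t1 t2 :
  short_exact F G -> induced_hor F i t1 -> induced_ver G (s i) t2 ->
  isomorphic (cok (rleg t2)) (kern (lleg t1)).
Proof.
intros FG [P [p [p' [PB [q [r [m [Eq [Er [Sm [a [b [Sa [Eb Et]]]]]]]]]]]]]]
  [Qb [q2 [q2' [PB2 [p2 [r2 [m2 [Ep2 [Er2 [Sm2 [ey [ey' [ez [ez'
  [Cy [Cz [a2 [b2 [Ea2 [Sb2 Et2]]]]]]]]]]]]]]]]]]]].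
apply isomorphic_trans with (cok b2).
{ destruct Et2 as [e [e' [H [_ Hr]]]]; simpl in *.
  refine (viso_over_isomorphic (coker_iso _)).
  exists e; split; [exact (same_hiso H)|trivial]. }
apply isomorphic_sym, isomorphic_trans with (kern a).
{ destruct Et as [e [e' [H [Hl _]]]]; simpl in *.
  destruct (@ker_iso A _ _ _ (lleg t1) a) as [d [Hd _]].
  - exists e'; split; [exact (same_viso H)|trivial].
  - now exists d. }
destruct (hmap_bar F) as [hb [S S']].
destruct (vmap_bar G) as [vb [T T']].
assert (Eqr : q ;v r = vbar X i).
{ apply (vmonic (w := coker (hleg X i))); now rewrite vcomp_assoc, Er, vbarE. }
destruct (ker_le (kcp_ker (vbar X i)) (kcp_ker r) Eqr) as [j Ej].
destruct (third_iso (kcp_ker (vbar X i)) (kcp_ker r) (kcp_ker q) Ej Eqr)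
  as [l [Sl Hl]].
rewrite (sq_left_unique Sl Sa) in Hl; clear l Sl.
apply isomorphic_trans with (kern r).
{ apply isomorphic_sym; exact (kcp_isomorphic_hor Hl (kcp_ker a)). }
destruct (proj2 PB _ _ _ (eq_sym (S' i))) as [e [[Ep Ep'] _]].
destruct (third_iso (kcp_coker p) (kcp_coker (hleg X i)) (kcp_ker r) Ep Er)
  as [l1 [_ L1]].
destruct (proj2 PB2 _ _ _ (eq_sym (T (s i)))) as [x [[Ex Ex'] _]].
(* Inside [bar Y (s i)] the subobjects [P] and [bar X (s i)] have quotients [bar Q (s i)] and [Qb].
   Hence [kern x], like [kern r], is [P] modulo [bar X (s i)]. *)
assert (K1 : ker_coker_pair p' (vb (s i))).
{ destruct (hpb_of_sq (T' i) (kcp_ker (vb (s i))) (FG i)) as [n Pn].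
  exact (h_pullback_unique (h_pullback_sym PB) Pn). }
assert (K2 : ker_coker_pair (hb (s i)) q2').
{ destruct (vpb_of_sq (S (s i)) (kcp_coker _) (FG (s i))) as [n Pn].
  apply kcp_op; exact (@h_pullback_unique (op A) _ _ _ _ _ _ _ _ _ _ _
    (@h_pullback_sym (op A) _ _ _ _ _ _ _ _ PB2) Pn). }
destruct (third_iso K1 K2 (kcp_ker x) Ep' Ex') as [l2 [_ L2]].
apply isomorphic_trans with (kern x); [exact (kcp_isomorphic_ver L1 L2)|].
(* Read inside [Q (s i)], the same [kern x] is the cycles modulo [kern q2]. *)
destruct (third_iso (kcp_ker (vleg Q (s i))) (kcp_ker q2) (kcp_ker x) Er2 Ex)
  as [l3 [_ L3]].
apply isomorphic_trans with (cok r2);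
  [exact (kcp_isomorphic_ver L3 (kcp_coker r2))|].
assert (Epr : p2 ;h r2 = hbar Q (s i)).
{ apply (hmonic (g := ker (vleg Q (s i)))); now rewrite hcomp_assoc, Er2, hbarE. }
assert (R : sq b2 (b2 ;h ez) (vid _) ez').
{ apply (proj2 (sq_viso _ _ (same_id _) (proj1 Cz))); now rewrite hcomp_id_l. }
pose proof (sq_vcomp R Sb2) as R2.
assert (K4 : ker_coker_pair (hbar Q (s i)) (ez' ;v coker (hbar Q (s i)))).
{ apply (kcp_viso (u := coker (hbar Q (s i)))); [|apply kcp_coker].
  exists ez'; split; [exact (same_viso (proj1 Cz))|reflexivity]. }
(* [coker b2] is the pullback of [coker r2] to the homology of [Q]; as [coker r2] already factors
   through that homology by [w], the pullback is [w] itself. *)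
destruct (coker_le (kcp_coker r2) K4 Epr) as [w Ew].
destruct (vpb_of_sq R2 (kcp_coker b2) (kcp_coker r2)) as [n Pn].
rewrite <- Ew in Pn.
apply isomorphic_sym; refine (viso_over_isomorphic (u := coker b2) (u' := w) _).
exact (@h_pullback_unique (op A) _ _ _ _ _ _ _ _ _ _ _ Pn
  (@h_pullback_factor (op A) _ _ _ w _)).
Qed.

End HomologyMaps.

(** * Characterization of induced maps by equations in A^flat *)

Section Flattening.
Context {A : ACGW}.

#[local] Instance span_eq_equiv (B C : A) : Equivalence (@span_eq A B C).
Proof.
split; [exact (@span_eq_refl A B C)|exact (@span_eq_sym A B C)|
  exact (@span_eq_trans A B C)].
Qed.

#[local] Instance span_comp_proper (B C E : A) :
  Proper (@span_eq A B C ==> @span_eq A C E ==> @span_eq A B E) (@span_comp A B C E).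
Proof. intros x x' H y y' K; exact (span_comp_eq H K). Qed.

Definition hspan (B C : A) (f : hor B C) : Span B C := MkSpan (vid B) f.
Definition vspan (B C : A) (u : ver B C) : Span C B := MkSpan u (hid B).

Lemma span_eta (B C : A) (t : Span B C) : MkSpan (lleg t) (rleg t) = t.
Proof. now destruct t. Qed.

Lemma span_comp_hspan (B C E : A) (t : Span B C) (f : hor C E) :
  span_eq (span_comp t (hspan f)) (MkSpan (lleg t) (rleg t ;h f)).
Proof.
symmetry; rewrite <- (vcomp_id_l (lleg t)).
apply (@span_comp_corner _ _ _ _ t (hspan f)), sq_vid.
Qed.

Lemma vspan_comp_span (B C E : A) (u : ver B C) (t : Span B E) :
  span_eq (span_comp (vspan u) t) (MkSpan (lleg t ;v u) (rleg t)).
Proof.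
symmetry; rewrite <- (hcomp_id_l (rleg t)).
apply (@span_comp_corner _ _ _ _ (vspan u) t), sq_hid.
Qed.

Lemma span_decomp (B C : A) (t : Span B C) :
  span_eq t (span_comp (vspan (lleg t)) (hspan (rleg t))).
Proof.
rewrite vspan_comp_span; simpl; now rewrite vcomp_id_l, span_eta.
Qed.

Lemma hspan_hcomp (B C E : A) (f : hor B C) (g : hor C E) :
  span_eq (hspan (f ;h g)) (span_comp (hspan f) (hspan g)).
Proof. now rewrite span_comp_hspan. Qed.

Lemma vspan_vcomp (B C E : A) (u : ver B C) (v : ver C E) :
  span_eq (vspan (u ;v v)) (span_comp (vspan v) (vspan u)).
Proof. now rewrite vspan_comp_span. Qed.

Lemma hspan_vspan (B C E F : A) (t : hor B C) (f : hor E F) (l : ver B E)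
    (v : ver C F) : sq t f l v ->
  span_eq (span_comp (hspan f) (vspan v)) (span_comp (vspan l) (hspan t)).
Proof.
intros S; rewrite vspan_comp_span; simpl; symmetry.
rewrite vcomp_id_l, <- (vcomp_id_r l), <- (hcomp_id_r t).
exact (@span_comp_corner _ _ _ _ (hspan f) (vspan v) _ _ _ S).
Qed.

Lemma hspan_cancel (B C E : A) (t t' : Span B C) (f : hor C E) :
  span_eq (span_comp t (hspan f)) (span_comp t' (hspan f)) -> span_eq t t'.
Proof.
rewrite !span_comp_hspan; intros [e [e' [H [Hl Hr]]]]; exists e, e'.
split; trivial; split; trivial.
apply (hmonic (g := f)); simpl in Hr; now rewrite hcomp_assoc.
Qed.

Lemma vspan_cancel (B C E : A) (t t' : Span B C) (u : ver B E) :
  span_eq (span_comp (vspan u) t) (span_comp (vspan u) t') -> span_eq t t'.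
Proof.
rewrite !vspan_comp_span; intros [e [e' [H [Hl Hr]]]]; exists e, e'.
split; trivial; split; trivial.
apply (vmonic (w := u)); simpl in Hl; now rewrite vcomp_assoc.
Qed.

Context {I : Type} {s : I -> I}.
Implicit Types X Y Z : Complex A s.

Lemma cycles_proj_ex X i : exists pi : ver (homology i X) (kern (vleg X i)),
  sq (ker (vbar X i)) (ker (vleg X i)) pi (coker (hleg X i)).
Proof.
destruct (homology_comparison_ex X i) as [e [e' [_ S]]]; eauto.
Qed.

(** Read backwards in A^flat, this is the projection from cycles onto homology. *)
Definition cycles_proj X i : ver (homology i X) (kern (vleg X i)) :=
  proj1_sig (constructive_indefinite_description _ (cycles_proj_ex X i)).

Lemma cycles_proj_sq X i :
  sq (ker (vbar X i)) (ker (vleg X i)) (cycles_proj X i) (coker (hleg X i)).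
Proof.
exact (proj2_sig (constructive_indefinite_description _ (cycles_proj_ex X i))).
Qed.

Lemma homology_comparison_proj X i (e : hor (homology i X) (homology' i X)) e' :
  homology_comparison e e' -> e' ;v coker (hbar X i) = cycles_proj X i.
Proof. intros [_ S]; exact (sq_left_unique S (cycles_proj_sq X i)). Qed.

(** A relation that composes by pasting and mentions only [f], not a factorization of it; [z] is the
    restriction of [f] to cycles. *)
Definition homology_map X Y i (f : Span (X i) (Y i))
    (t : Span (homology i X) (homology i Y)) : Prop :=
  exists z : Span (kern (vleg X i)) (kern (vleg Y i)),
    span_eq (span_comp (hspan (ker (vleg X i))) f)
            (span_comp z (hspan (ker (vleg Y i)))) /\
    span_eq (span_comp z (vspan (cycles_proj Y i)))
            (span_comp (vspan (cycles_proj X i)) t).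

Lemma homology_map_unique X Y i (f f' : Span (X i) (Y i)) t t' :
  span_eq f f' -> homology_map f t -> homology_map f' t' -> span_eq t t'.
Proof.
intros H [z [E1 E2]] [z' [E1' E2']].
assert (Hz : span_eq z z').
{ apply (hspan_cancel (f := ker (vleg Y i))); now rewrite <- E1, H, E1'. }
apply (vspan_cancel (u := cycles_proj X i)); now rewrite <- E2, <- E2', Hz.
Qed.

Lemma homology_map_eq X Y i (f f' : Span (X i) (Y i)) t t' :
  span_eq f f' -> span_eq t t' -> homology_map f t -> homology_map f' t'.
Proof. intros H K [z [E1 E2]]; exists z; split; [now rewrite <- H|now rewrite <- K]. Qed.

Lemma homology_map_id X i : homology_map (span_id (X i)) (span_id (homology i X)).
Proof.
exists (span_id _); split.
- now rewrite (span_comp_id_l (hspan _)), (span_comp_id_r (hspan _)).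
- now rewrite (span_comp_id_l (vspan _)), (span_comp_id_r (vspan _)).
Qed.

Lemma homology_map_comp X Y Z i (f : Span (X i) (Y i)) (g : Span (Y i) (Z i)) t t' :
  homology_map f t -> homology_map g t' ->
  homology_map (X := X) (Y := Z) (span_comp f g) (span_comp t t').
Proof.
intros [z [E1 E2]] [z' [E1' E2']]; exists (span_comp z z'); split.
- now rewrite <- span_comp_assoc, E1, span_comp_assoc, E1', span_comp_assoc.
- now rewrite span_comp_assoc, E2', <- span_comp_assoc, E2, span_comp_assoc.
Qed.

Lemma induced_ver_homology_map Z Y (G : VerMap Z Y) i t :
  induced_ver G i t -> homology_map (vspan (G i)) t.
Proof.
intros [Qb [q [q' [_ [p [r [m [_ [Er [Sm [ey [ey' [ez [ez'
  [Cy [Cz [a [b [Ea [Sb Et]]]]]]]]]]]]]]]]]]]].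
rewrite vcomp_assoc, (homology_comparison_proj Cy) in Ea.
assert (R : sq b (b ;h ez) (vid _) ez').
{ apply (proj2 (sq_viso _ _ (same_id _) (proj1 Cz))); now rewrite hcomp_id_l. }
pose proof (sq_vcomp R Sb) as R2.
rewrite vcomp_id_l, (homology_comparison_proj Cz) in R2.
(* On cycles, the map restricts to the span through [kern q]. *)
exists (span_comp (vspan m) (hspan r)); split.
- now rewrite (hspan_vspan Sm), <- Er, hspan_hcomp, span_comp_assoc.
- rewrite span_comp_assoc, (hspan_vspan R2), <- span_comp_assoc, <- vspan_vcomp.
  now rewrite <- Ea, vspan_vcomp, span_comp_assoc, Et, (span_decomp (MkSpan a b)).
Qed.

Lemma induced_hor_homology_map X Y (F : HorMap X Y) i t :
  induced_hor F i t -> homology_map (hspan (F i)) t.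
Proof.
intros [P [p [p' [PB [q [r [m [Eq [Er [Sm [a [b [Sa [Eb Et]]]]]]]]]]]]]].
destruct (hmap_bar F) as [hb [S _]].
destruct (hpb_of_sq (S i) (kcp_ker _) (kcp_ker _)) as [mz [Hmz _]].
assert (Ez : span_eq (span_comp (hspan (ker (vleg X i))) (hspan (F i)))
    (span_comp (hspan mz) (hspan (ker (vleg Y i)))))
  by now rewrite <- !hspan_hcomp, Hmz.
exists (hspan mz); split; trivial.
(* The equation is checked after the monic from homology into [cok (hleg Y i)], where every factor
   belongs to a known square. *)
apply (hspan_cancel (f := ker (vbar Y i))).
rewrite span_comp_assoc, <- (hspan_vspan (cycles_proj_sq Y i)).
rewrite <- span_comp_assoc, <- Ez, span_comp_assoc, (hspan_vspan Sm), <- Er.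
rewrite vspan_vcomp, span_comp_assoc, <- span_comp_assoc.
rewrite (hspan_vspan (cycles_proj_sq X i)), !span_comp_assoc.
rewrite <- (span_comp_assoc (hspan (ker (vbar X i)))), (hspan_vspan Sa).
rewrite span_comp_assoc, <- hspan_hcomp, <- Eb, hspan_hcomp.
now rewrite <- (span_comp_assoc (vspan a)), Et, (span_decomp (MkSpan a b)).
Qed.

Lemma induced_homology_map X Y (f : ChainMap X Y) i t :
  induced f i t -> homology_map (f i) t.
Proof.
intros [Z [G [F [Hf [t1 [t2 [H1 [H2 Et]]]]]]]].
apply (homology_map_eq (f := span_comp (vspan (G i)) (hspan (F i)))
  (t := span_comp t1 t2)).
- now rewrite (Hf i), (span_decomp (MkSpan (G i) (F i))).
- now symmetry.
- exact (homology_map_comp (induced_ver_homology_map H1)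
    (induced_hor_homology_map H2)).
Qed.

End Flattening.

(** * Factoring a chain map through a complex *)

Lemma succ_choice (T : Z -> Type) (R : forall i, T (Z.succ i) -> Prop) :
  (forall i, exists d, R i d) -> exists d : forall i, T i, forall i, R i (d (Z.succ i)).
Proof.
intros H.
set (g i := proj1_sig (constructive_indefinite_description _ (H i))).
assert (Hg : forall i, R i (g i))
  by (intros i; exact (proj2_sig (constructive_indefinite_description _ (H i)))).
(* The value at [i] is the choice made at [Z.pred i]; uniqueness of identity proofs on integers
   removes the cast at successors. *)
exists (fun i => eq_rect _ T (g (Z.pred i)) i (Z.succ_pred i)).
intros i; generalize (Z.succ_pred (Z.succ i)); rewrite Z.pred_succ; intros e.
now rewrite (UIP_dec Z.eq_dec e eq_refl).
Qed.

Section Factorization.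
Context {A : ACGW}.

(** Initiality and monicity make any vertical morphism into the empty object inverse to [vinit]. *)
Lemma is_empty_of_ver (B C : A) (u : ver B C) : is_empty C -> is_empty B.
Proof.
intros H; destruct (same_of_h H) as [v [K _]].
destruct (same_inv K) as [_ [w [_ [_ [_ [_ E]]]]]].
assert (V : is_viso (u ;v w)).
{ exists (vinit B); split.
  - apply (vmonic (w := u ;v w)).
    now rewrite vcomp_assoc, (vinit_unique (vinit B ;v _)),
      <- (vinit_unique (vid _)), vcomp_id_l, vcomp_id_r.
  - now rewrite (vinit_unique (_ ;v _)), (vinit_unique (vid _)). }
destruct (same_of_v V) as [f [F _]].
destruct (same_hiso F) as [g [H1 H2]].
apply (is_empty_of_hiso (f := g)); now exists f.
Qed.

(** The corner of [h] and [v] is also a corner of [h'] and [y ;v v'], so it maps vertically to the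
    empty corner of [h'] and [v']. *)
Lemma zero_at_restrict (U X V U' X' V' : A) (h : hor U X) (v : ver V X)
    (h' : hor U' X') (v' : ver V' X') (x : ver U U') (y : ver V V') (z : ver X X') :
  sq h h' x z -> v ;v z = y ;v v' -> zero_at h' v' -> zero_at h v.
Proof.
intros S E Z.
pose proof (sq_vcomp (mix_sq h v) S) as S1; rewrite E in S1.
destruct (mix_unique2 S1 (sq_vcomp (mix_sq (mix_top h' v') y) (mix_sq h' v')))
  as [e [e' _]].
exact (is_empty_of_ver (e' ;v mix_left (mix_top h' v') y) Z).
Qed.

(** The barred object at [i] with the legs that stay at index [i]. The leg to the middle object one
    degree lower is chosen later, at successor indices, which avoids casts. *)
Record MiddleBar (X Y : Complex A Z.succ) (f : ChainMap X Y) (i : Z) : Type := {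
  mbar : A;
  mbar_mid : ver mbar (mid (f i));
  mbar_src : ver mbar (bar X i);
  mbar_tgt : hor mbar (bar Y i)
}.

Lemma chain_map_factor (X Y : Complex A Z.succ) (f : ChainMap X Y) :
  exists (W : Complex A Z.succ) (G : VerMap W X) (F : HorMap W Y),
    forall j, span_eq (f j) (MkSpan (G j) (F j)).
Proof.
destruct (succ_choice (T := MiddleBar f) (R := fun i d =>
  (mbar_mid d ;v lleg (f (Z.succ i)) = mbar_src d ;v vleg X (Z.succ i) /\
   sq (mbar_tgt d) (rleg (f (Z.succ i))) (mbar_mid d) (vleg Y (Z.succ i))) /\
  exists h : hor (mbar d) (mid (f i)),
    h ;h rleg (f i) = mbar_tgt d ;h hleg Y i /\
    sq h (hleg X i) (mbar_src d) (lleg (f i)))) as [d Hd].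
{ intros i; destruct (component_chain f i) as [zb [v [h [x [y [E1 [E2 [S1 S2]]]]]]]].
  exists {| mbar := zb; mbar_mid := v; mbar_src := x; mbar_tgt := y |}; eauto. }
assert (Hv : forall i,
    mbar_mid (d i) ;v lleg (f i) = mbar_src (d i) ;v vleg X i /\
    sq (mbar_tgt (d i)) (rleg (f i)) (mbar_mid (d i)) (vleg Y i)).
{ intros i; rewrite <- (Z.succ_pred i); apply Hd. }
set (h i := constructive_indefinite_description _ (proj2 (Hd i))).
assert (Hh : forall i,
    proj1_sig (h i) ;h rleg (f i) = mbar_tgt (d (Z.succ i)) ;h hleg Y i /\
    sq (proj1_sig (h i)) (hleg X i) (mbar_src (d (Z.succ i))) (lleg (f i)))
  by (intros i; exact (proj2_sig (h i))).
set (D := Build_Differentials (s := Z.succ) (X := fun i => mid (f i))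
  (fun i => mbar_mid (d i)) (fun i => proj1_sig (h i))).
assert (D0 : forall i, zero_at (dhor D i) (dver D i)).
{ intros i.
  exact (zero_at_restrict (proj2 (Hh i)) (proj1 (Hv i)) (czero X i)). }
set (W := MkComplex D D0).
assert (HG : exists vb : forall i, ver (bar W i) (bar X i), forall i,
  vb i ;v vleg X i = vleg W i ;v lleg (f i) /\
  sq (hleg W i) (hleg X i) (vb (Z.succ i)) (lleg (f i))).
{ exists (fun i => mbar_src (d i)); intros i; split;
    [symmetry; apply Hv|apply Hh]. }
assert (HF : exists hb : forall i, hor (bar W i) (bar Y i), forall i,
  sq (hb i) (rleg (f i)) (vleg W i) (vleg Y i) /\
  hb (Z.succ i) ;h hleg Y i = hleg W i ;h rleg (f i)).
{ exists (fun i => mbar_tgt (d i)); intros i; split;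
    [apply Hv|symmetry; apply Hh]. }
exists W, (Build_VerMap (X := W) HG), (Build_HorMap (X := W) HF).
intros j; simpl; rewrite span_eta; apply span_eq_refl.
Qed.

Lemma induced_ex (X Y : Complex A Z.succ) (f : ChainMap X Y) n :
  exists t, induced f n t.
Proof.
destruct (chain_map_factor f) as [W [G [F H]]].
destruct (induced_ver_ex G n) as [t1 H1], (induced_hor_ex F n) as [t2 H2].
exists (span_comp t1 t2), W, G, F; split; trivial.
exists t1, t2; repeat split; trivial; apply span_eq_refl.
Qed.

End Factorization.

(** * Assembling the long exact sequence *)

Section LongExactSequence.
Context {A : ACGW}.

Lemma long_exact_sequence (X Y Q : Complex A Z.succ) (F : HorMap X Y) (G : VerMap Q Y) :
  short_exact F G ->
  exists (d : Differentials les_succ (les_ob X Y Q))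
    (d_zero : forall n, zero_at (dhor d n) (dver d n)),
    exact (MkComplex d d_zero) /\
    forall i : Z,
      induced_hor F i (MkSpan (dver d (i, Sub)) (dhor d (i, Total))) /\
      induced_ver G i (MkSpan (dver d (i, Total)) (dhor d (i, Quot))).
Proof.
intros FG.
set (t1 i := proj1_sig (constructive_indefinite_description _ (induced_hor_ex F i))).
assert (H1 : forall i, induced_hor F i (t1 i)) by (intros i;
  exact (proj2_sig (constructive_indefinite_description _ (induced_hor_ex F i)))).
set (t2 i := proj1_sig (constructive_indefinite_description _ (induced_ver_ex G i))).
assert (H2 : forall i, induced_ver G i (t2 i)) by (intros i;
  exact (proj2_sig (constructive_indefinite_description _ (induced_ver_ex G i)))).
set (c i := constructive_indefinite_description _
  (connecting FG (H1 i) (H2 (Z.succ i)))).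
(* The connecting morphism is the cokernel of [rleg (t2 (Z.succ i))] identified by [c i] with the
   kernel of [lleg (t1 i)], so exactness at the [Quot] and [Sub] terms is built in. *)
set (b n := match n with
  | (i, Sub) => mid (t1 i)
  | (i, Total) => mid (t2 i)
  | (i, Quot) => cok (rleg (t2 i))
  end).
set (v n := match n return ver (b n) (les_ob X Y Q n) with
  | (i, Sub) => lleg (t1 i)
  | (i, Total) => lleg (t2 i)
  | (i, Quot) => coker (rleg (t2 i))
  end).
set (h n := match n return hor (b (les_succ n)) (les_ob X Y Q n) with
  | (i, Sub) => proj1_sig (c i) ;h ker (lleg (t1 i))
  | (i, Total) => rleg (t1 i)
  | (i, Quot) => rleg (t2 i)
  end).
set (d := {| dbar := b; dver := v; dhor := h |}).
assert (K : forall n, ker_coker_pair (dhor d n) (dver d n)).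
{ intros [i []]; simpl.
  - exists (proj1_sig (c i)); split; [exact (proj2_sig (c i))|reflexivity].
  - exact (exact_at_total FG (H1 i) (H2 i)).
  - apply kcp_coker. }
exists d, (fun n => kcp_zero_at (K n)); split.
- intros n; exact (kcp_to_coker _ (K n)).
- intros i; simpl; rewrite !span_eta; auto.
Qed.

End LongExactSequence.

Theorem theorem1p4 (A : ACGW) :
  (* functoriality of homology *)
  (forall n : Z,
     exists H : FunctorOn (C := Ch A) (D := Flat A) (homology n),
     forall (X Y : Complex A Z.succ) (f : ChainMap X Y),
       induced f n (fmap H f))
  /\
  (* snake lemma *)
  (forall (A0 Ab B C X Y Z A' B' Cb' C' : A)
     (Ab_A : ver Ab A0) (Ab_B : hor Ab B) (C_B : ver C B)
     (X_Y : hor X Y) (Z_Y : ver Z Y)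
     (A'_B' : hor A' B') (Cb'_B' : ver Cb' B') (Cb'_C' : hor Cb' C')
     (X_A : ver X A0) (X_Ab : ver X Ab) (Y_B : ver Y B) (Z_C : ver Z C)
     (X_A' : hor X A') (Y_B' : hor Y B') (Z_Cb' : hor Z Cb') (Z_C' : hor Z C'),
     ker_coker_pair Ab_B C_B ->
     ker_coker_pair A'_B' Cb'_B' ->
     X_Ab ;v Ab_A = X_A ->
     sq X_Y Ab_B X_Ab Y_B ->
     Z_Y ;v Y_B = Z_C ;v C_B ->
     X_Y ;h Y_B' = X_A' ;h A'_B' ->
     sq Z_Cb' Y_B' Z_Y Cb'_B' ->
     Z_Cb' ;h Cb'_C' = Z_C' ->
     exists (D W D' : A)
       (_ : ver (kern X_Ab) (kern X_A))
       (f1 : hor (kern X_Ab) (kern Y_B)) (g1 : ver D (kern Y_B))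
       (f2 : hor D (kern Z_C)) (g2 : ver W (kern Z_C))
       (f3 : hor W (cok X_A')) (g3 : ver D' (cok X_A'))
       (f4 : hor D' (cok Y_B')) (g4 : ver (cok Z_Cb') (cok Y_B'))
       (_ : hor (cok Z_Cb') (cok Z_C')),
       ker_coker_pair f1 g1 /\ ker_coker_pair f2 g2 /\
       ker_coker_pair f3 g3 /\ ker_coker_pair f4 g4)
  /\
  (* long exact sequence of a relative pair *)
  (forall (X Y Q : Complex A Z.succ) (F : HorMap X Y) (G : VerMap Q Y),
     short_exact F G ->
     exists (d : Differentials les_succ (les_ob X Y Q))
       (d_zero : forall n, zero_at (dhor d n) (dver d n)),
       exact (MkComplex d d_zero) /\
       forall i : Z,
         induced_hor F i
           (MkSpan (dver d (i, Sub)) (dhor d (i, Total))) /\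
         induced_ver G i
           (MkSpan (dver d (i, Total)) (dhor d (i, Quot)))).
Proof.
split; [|split].
- intros n.
  set (H (X Y : Complex A Z.succ) (f : ChainMap X Y) :=
    constructive_indefinite_description _ (induced_ex f n)).
  assert (HI : forall (X Y : Complex A Z.succ) (f : ChainMap X Y), induced f n (proj1_sig (H X Y f)))
    by (intros X Y f; exact (proj2_sig (H X Y f))).
  assert (HM : forall (X Y : Complex A Z.succ) (f : ChainMap X Y), homology_map (f n) (proj1_sig (H X Y f)))
    by (intros X Y f; exact (induced_homology_map (HI X Y f))).
  unshelve eexists (Build_FunctorOn (C := Ch A) (D := Flat A) (F := homology n)
    (fmap := fun (X Y : Complex A Z.succ) f => proj1_sig (H X Y f)) _ _ _).
  (* Each functor law compares two spans satisfying [homology_map] for equal maps. *)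
  + intros X Y f g E; exact (homology_map_unique (E n) (HM X Y f) (HM X Y g)).
  + intros X; exact (homology_map_unique (span_eq_refl _) (HM X X (chain_id X))
      (homology_map_id X n)).
  + intros X Y W f g; exact (homology_map_unique (span_eq_refl _)
      (HM X W (chain_comp f g)) (homology_map_comp (HM X Y f) (HM Y W g))).
  + intros X Y f; exact (HI X Y f).
- exact (@snake A).
- exact (@long_exact_sequence A).
Qed.
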